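(* Let $n=3$, let $M$ be a compact manifold of dimension $n$, and let $g=g(t)$ be a smooth solution of the Ricci flow $\frac{\partial g}{\partial t}=-2\,\mathrm{Ric}$ on $M\times[0,T)$ (with $T>0$ finite or infinite) with initial metric $g(0)=g_0$. Assume $\lambda_0(g_0)=0$. Let $A,B>0$ be constants depending only on $(M,g_0)$ such that for each $t\in[0,T)$ $$\left(\int_M |u|^{\frac{2n}{n-2}}\,dvol\right)^{\frac{n-2}{n}}\le A\int_M\Big(|\nabla u|^2+\frac R4u^2\Big)dvol+B\int_M u^2\,dvol\qquad\text{for all }u\in W^{1,2}(M),$$ with $|\nabla u|$, the scalar curvature $R$ and the volume form $dvol$ taken with respect to $g(t)$. Let $L>0$ and $t\in[0,T)$, and consider the Riemannian manifold $(M,g)$ with $g=g(t)$. Assume $R\le \frac1{r^2}$ on a geodesic ball $B(x,r)$ with $0<r\le L$. Then $$vol(B(x,r))\ge\left(\frac{1}{2^{n+3}A+2BL^2}\right)^{\frac n2}r^n.$$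
   Context: Manifolds are connected and without boundary. For a Riemannian metric $g$ on the compact manifold $M$, $\lambda_0(g)$ denotes the smallest eigenvalue of $-\Delta+\frac{R}{4}$, where $\Delta$ is the Laplace-Beltrami operator ($\Delta=\mathrm{div}\,\nabla$) and $R$ the scalar curvature of $g$. Constants $A,B$ as in the claim exist under the assumption $\lambda_0(g_0)=0$; moreover, for given $v_0>0$, $D_0>0$ they can be chosen depending only on $v_0,D_0$ if $vol_{g_0}(M)\ge v_0$, $diam_{g_0}(M)\le D_0$, the Riemann curvature tensor satisfies $|Rm|_{g_0}\le 1$ on $M$, and $T\ge 2\alpha(3)$, where $\alpha(n)>0$ is a fixed constant depending only on $n$ such that every Ricci flow solution on a compact $n$-manifold whose initial metric satisfies $|Rm|\le 1$ extends to a smooth solution on $[0,T')$ with $T'\ge 2\alpha(n)$, and satisfies $|Rm|\le 2$ on $[0,\alpha(n)]$. *)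

(* Defs.v *)
From HB Require Import structures.
From mathcomp Require Import all_boot all_order all_algebra.
From mathcomp Require Import all_classical all_reals all_analysis.
Set Implicit Arguments.
Unset Strict Implicit.
Unset Printing Implicit Defensive.
Import Order.TTheory GRing.Theory Num.Theory.
Import numFieldNormedType.Exports.
Local Open Scope classical_set_scope.
Local Open Scope ring_scope.

Notation borel T := (g_sigma_algebraType (@open T)).

Section Smoothness.
Variables (R : realType) (V : normedModType R).

(* Meant for open U: all iterated directional derivatives of order at most k
   exist and are continuous on U, which in finite dimension is the class C^k. *)
Fixpoint Ck_on (k : nat) (U : set V) (f : V -> R) : Prop :=
  (forall x, U x -> {for x, continuous f}) /\
  match k with
  | 0 => True
  | k'.+1 => forall v, (forall x, U x -> derivable f x v) /\
                       Ck_on k' U (fun x => 'D_v f x)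
  end.

Definition smooth_on (U : set V) (f : V -> R) : Prop := forall k, Ck_on k U f.

(* Smoothness on an arbitrary set, such as U x [0, T): local existence of
   smooth extensions. *)
Definition smooth_upto (S : set V) (f : V -> R) : Prop :=
  forall a, S a -> exists W : set V, exists h : V -> R,
    [/\ open W, W a, smooth_on W h & forall x, S x -> W x -> f x = h x].

End Smoothness.

(* Lebesgue measure on R^n, by Cavalieri's principle; only its values on Borel
   sets are meaningful. *)
Fixpoint lebesgue_rV (R : realType) (n : nat) :
    set (borel 'rV[R]_n) -> \bar R :=
  match n with
  | 0 => fun E => (\1_E (0 : 'rV[R]_0))%:E
  | m.+1 => fun E => (\int[@lebesgue_measure R]_x
      @lebesgue_rV R m [set v | E (row_mx (x%:M : 'rV[R]_1) v)])%E
  end.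

(* Riemannian geometry of a metric tensor h given in coordinates. *)
Section Coordinates.
Variables (R : realType) (n : nat).
Implicit Types (h : 'rV[R]_n -> 'M[R]_n) (f : 'rV[R]_n -> R) (i j k : 'I_n).

Definition partial i f (y : 'rV[R]_n) : R := 'D_(delta_mx 0 i) f y.

Definition christoffel h k i j (y : 'rV[R]_n) : R :=
  2^-1 * \sum_(l < n) invmx (h y) k l *
    (partial i (fun z => h z j l) y + partial j (fun z => h z i l) y
     - partial l (fun z => h z i j) y).

(* Sign convention: the round sphere has positive Ricci curvature. *)
Definition ricci h i j (y : 'rV[R]_n) : R :=
  \sum_(k < n) (partial k (christoffel h k i j) y
                - partial j (christoffel h k i k) y) +
  \sum_(k < n) \sum_(l < n)
    (christoffel h k k l y * christoffel h l i j y
     - christoffel h k j l y * christoffel h l i k y).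

Definition scal h (y : 'rV[R]_n) : R :=
  \sum_(i < n) \sum_(j < n) invmx (h y) i j * ricci h i j y.

Definition vol_density h (y : 'rV[R]_n) : R := Num.sqrt (\det (h y)).

Definition gradient h f i (y : 'rV[R]_n) : R :=
  \sum_(j < n) invmx (h y) i j * partial j f y.

Definition divergence h (X : 'I_n -> 'rV[R]_n -> R) (y : 'rV[R]_n) : R :=
  (vol_density h y)^-1 *
    \sum_(i < n) partial i (fun z => vol_density h z * X i z) y.

Definition laplacian h f : 'rV[R]_n -> R := divergence h (gradient h f).

(* Only the restriction of the curve to [0, 1] matters. *)
Definition C1_curve (gam : R -> 'rV[R]_n) : Prop :=
  (forall s, derivable gam s 1) /\ continuous (derive1 gam).

Definition curve_length h (gam : R -> 'rV[R]_n) : R :=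
  \int[@lebesgue_measure R]_(s in `[0, 1])
    Num.sqrt ((derive1 gam s *m h (gam s) *m (derive1 gam s)^T) 0 0).

End Coordinates.

Section Charts.
Variables (R : realType) (M : ptopologicalType) (n : nat).

Record chart := Chart {
  chart_dom : set M;
  chart_coord : M -> 'rV[R]_n;
  chart_param : 'rV[R]_n -> M
}.

Definition chart_img (c : chart) : set 'rV[R]_n := chart_coord c @` chart_dom c.

Definition is_chart (c : chart) : Prop :=
  [/\ open (chart_dom c), open (chart_img c),
      forall p, chart_dom c p -> chart_param c (chart_coord c p) = p,
      {within chart_dom c, continuous (chart_coord c)} &
      {within chart_img c, continuous (chart_param c)}].

(* A smooth manifold without boundary of dimension n, given by a smooth atlas;
   chart_at selects a chart around each point. *)
Record smooth_structure := SmoothStructure {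
  atlas : set chart;
  chart_at : M -> chart;
  manifold_hausdorff : hausdorff_space M;
  manifold_second_countable : @second_countable M;
  atlas_chart : forall c, atlas c -> is_chart c;
  chart_at_atlas : forall p, atlas (chart_at p);
  chart_at_dom : forall p, chart_dom (chart_at p) p;
  transition_smooth : forall c c', atlas c -> atlas c' -> forall k : 'I_n,
    smooth_on (chart_coord c @` (chart_dom c `&` chart_dom c'))
              (fun y => chart_coord c' (chart_param c y) 0 k)
}.

End Charts.

Section Riemannian.
Variables (R : realType) (M : ptopologicalType) (n : nat).
Variable X : smooth_structure R M n.
Local Notation chart := (chart R M n).

(* Rows are indexed by the coordinates of c', columns by those of c. *)
Definition transition_jacobian (c c' : chart) (y : 'rV[R]_n) : 'M[R]_n :=
  \matrix_(k < n, i < n) partial i (fun z => chart_coord c' (chart_param c z) 0 k) y.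

(* A metric is given by its components g_ij in each chart of the atlas, as
   functions of the coordinates; values off the image of a chart are junk. *)
Definition metric_tensor := chart -> 'rV[R]_n -> 'M[R]_n.

Definition is_riemannian (g : metric_tensor) : Prop :=
  [/\ forall c (i j : 'I_n), atlas X c ->
        smooth_on (chart_img c) (fun y => g c y i j),
      forall c y, atlas X c -> chart_img c y -> (g c y)^T = g c y,
      forall c y (v : 'rV[R]_n), atlas X c -> chart_img c y -> v != 0 ->
        0 < (v *m g c y *m v^T) 0 0 &
      forall c c' p, atlas X c -> atlas X c' ->
        chart_dom c p -> chart_dom c' p ->
        let J := transition_jacobian c c' (chart_coord c p) in
        g c (chart_coord c p) = J^T *m g c' (chart_coord c' p) *m J].

(* chart_at serves only to pick a chart: scal is a scalar invariant. *)
Definition scalar_curvature (g : metric_tensor) (p : M) : R :=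
  let c := chart_at X p in scal (g c) (chart_coord c p).

(* The Riemannian volume dvol is the unique Borel measure with density
   sqrt (det g_ij) in every chart. *)
Definition is_volume (g : metric_tensor)
    (vol : {measure set (borel M) -> \bar R}) : Prop :=
  forall c (E : set (borel M)), atlas X c -> measurable E ->
    E `<=` chart_dom c ->
    vol E = (\int[@lebesgue_rV R n]_(y in (chart_coord c @` E : set (borel 'rV[R]_n)))
               (vol_density (g c) y)%:E)%E.

(* path_of_length g p q l: some piecewise C^1 curve from p to q, cut into
   finitely many pieces each lying in the domain of one chart, has length l. *)
Inductive path_of_length (g : metric_tensor) : M -> M -> R -> Prop :=
| path_nil p : path_of_length g p p 0
| path_cons c (gam : R -> 'rV[R]_n) q l :
    atlas X c -> C1_curve gam ->
    (forall s, 0 <= s <= 1 -> chart_img c (gam s)) ->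
    path_of_length g (chart_param c (gam 1)) q l ->
    path_of_length g (chart_param c (gam 0)) q (curve_length (g c) gam + l).

Definition riem_dist (g : metric_tensor) (p q : M) : \bar R :=
  ereal_inf [set l%:E | l in path_of_length g p q].

Definition geodesic_ball (g : metric_tensor) (x : M) (r : R) : set M :=
  [set y | (riem_dist g x y < r%:E)%E].

(* Eigenvalues of - Delta + R / 4, with smooth eigenfunctions. *)
Definition is_eigenvalue (g : metric_tensor) (lam : R) : Prop :=
  exists u : M -> R,
    [/\ forall c, atlas X c -> smooth_on (chart_img c) (u \o chart_param c),
        exists p, u p != 0 &
        forall c y, atlas X c -> chart_img c y ->
          - laplacian (g c) (u \o chart_param c) y
            + scal (g c) y / 4 * u (chart_param c y) = lam * u (chart_param c y)].

Definition is_lambda0 (g : metric_tensor) (lam : R) : Prop :=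
  is_eigenvalue g lam /\ forall mu, is_eigenvalue g mu -> lam <= mu.

(* Smooth solution on M x [0, T) of dg/dt = - 2 Ric with g(0) = g0; the time
   derivative at t = 0 is one-sided. *)
Definition is_ricci_flow (T : \bar R) (g0 : metric_tensor)
    (g : R -> metric_tensor) : Prop :=
  let time := [set t : R | 0 <= t /\ (t%:E < T)%E] in
  [/\ forall t, time t -> is_riemannian (g t),
      forall c (i j : 'I_n), atlas X c ->
        smooth_upto (chart_img c `*` time)
          (fun z : 'rV[R]_n * R => g z.2 c z.1 i j),
      forall t c y (i j : 'I_n), time t -> atlas X c -> chart_img c y ->
        (fun s => (s - t)^-1 * (g s c y i j - g t c y i j))
          @ within time t^' --> - 2 * ricci (g t c) i j y &
      forall c y, atlas X c -> chart_img c y -> g 0 c y = g0 c y].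

(* A measurable section of T*M: om c p lists the components at p in chart c. *)
Definition covector_field := chart -> M -> 'rV[R]_n.

Definition is_covector_field (om : covector_field) : Prop :=
  (forall c (i : 'I_n), atlas X c ->
     measurable_fun (chart_dom c : set (borel M))
       ((fun p => om c p 0 i) : borel M -> R)) /\
  (forall c c' p, atlas X c -> atlas X c' ->
     chart_dom c p -> chart_dom c' p ->
     om c p = om c' p *m transition_jacobian c c' (chart_coord c p)).

Definition test_function (U : set 'rV[R]_n) (phi : 'rV[R]_n -> R) : Prop :=
  smooth_on [set: 'rV[R]_n] phi /\
  exists K : set 'rV[R]_n,
    [/\ compact K, K `<=` U & forall y, ~ K y -> phi y = 0].

(* om is the weak differential du; test functions vanish off the image of c,
   so the junk values of chart_param c there do not contribute. *)
Definition is_weak_differential (u : M -> R) (om : covector_field) : Prop :=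
  forall c (i : 'I_n) phi, atlas X c -> test_function (chart_img c) phi ->
    (\int[@lebesgue_rV R n]_y (u (chart_param c y) * partial i phi y)%:E =
     - \int[@lebesgue_rV R n]_y (om c (chart_param c y) 0 i * phi y)%:E)%E.

(* g^ij om_i om_j, independent of the chart; for om = du it is |nabla u|^2. *)
Definition covector_sqnorm (g : metric_tensor) (om : covector_field) (p : M) : R :=
  let c := chart_at X p in
  (om c p *m invmx (g c (chart_coord c p)) *m (om c p)^T) 0 0.

(* u is in W^{1,2}(M), with weak differential om. For compact M this does not
   depend on the metric g used to express square integrability. *)
Definition in_W12 (g : metric_tensor) (vol : {measure set (borel M) -> \bar R})
    (u : M -> R) (om : covector_field) : Prop :=
  [/\ measurable_fun [set: borel M] (u : borel M -> R),
      is_covector_field om,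
      is_weak_differential u om,
      (\int[vol]_p (u p ^+ 2)%:E < +oo)%E &
      (\int[vol]_p (covector_sqnorm g om p)%:E < +oo)%E].

Definition sobolev_inequality (g : metric_tensor)
    (vol : {measure set (borel M) -> \bar R}) (A B : R) : Prop :=
  forall u om, in_W12 g vol u om ->
    ((\int[vol]_p (`|u p| `^ (2 * n%:R / (n%:R - 2)))%:E)
         `^ ((n%:R - 2) / n%:R)
     <= A%:E * \int[vol]_p
                 (covector_sqnorm g om p + scalar_curvature g p / 4 * u p ^+ 2)%:E
        + B%:E * \int[vol]_p (u p ^+ 2)%:E)%E.

End Riemannian.

(* Main.v *)
Require Import Defs.
From HB Require Import structures.
From mathcomp Require Import all_boot all_order all_algebra.
From mathcomp Require Import all_classical all_reals all_analysis.
From mathcomp Require Import measurable_realfun.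
From mathcomp Require Import ring lra.
Set Implicit Arguments.
Unset Strict Implicit.
Unset Printing Implicit Defensive.
Import Order.TTheory GRing.Theory Num.Theory.
Import numFieldNormedType.Exports.
Local Open Scope classical_set_scope.
Local Open Scope ring_scope.

(** Why the theorem is true. Fix the time and write V(rho) for the volume of
B(x, rho). Put D = 1 / (64 A + 2 B L^2) and suppose that V(r) < D^(3/2) r^3.
For rho <= r apply the Sobolev inequality to a cutoff u of size rho that
vanishes off B(x, rho), is at least 49/100 rho on B(x, rho / 2) and has gradient
at most 5/2. By Hölder's inequality the integral of u^2 is at most
N V(rho)^(2/3), where N is the cube root of the integral of u^6. As
V(rho) <= V(r) and the scalar curvature is at most 1 / r^2, the terms with u^2
are then absorbed into N, and there remains
  (51/5) D N <= V(rho),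
whence 8 D^3 rho^6 V(rho / 2) <= V(rho)^3 (volume_halving). For
e(rho) = V(rho) / (D^(1/2) rho)^3 this says e(rho / 2) <= e(rho)^3. Since
e(r) < 1, iteration drives e(r / 2^m) to zero, which contradicts the fact that
small balls have volume at least a constant times the cube of their radius
(small_ball_volume).

The ideal cutoff is the tent function of the distance, with gradient 1 and
values at least rho / 2 on the inner ball. The coefficient 2^6 of A leaves room for a cutoff that
loses a constant factor in the gradient, and this allows u to be of class C^1
(cutoff_exists): u is the logarithm of a sum of large powers of bump functions,
each supported in a small frame, that is, a chart in which the metric is nearly
constant, and weighted by the exponential of minus the distance of its centre
to x. Distances enter only through the triangle inequality and straight segments
in frames.

A C^1 function has its classical differential as weak differential
(diff_form_weak_differential): in a chart this is integration by parts for
Lebesgue measure on R^n (integration_by_parts_rV), which follows from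
translation invariance. That the iterated one-dimensional integral is a
translation invariant measure on Borel sets is lebesgue_rV_measure together with
lebesgue_rV_shift. *)

(** * Lebesgue measure on R^n *)

Section LebesgueMeasure.
Variable R : realType.

(** The measure structure of a pushforward mentions the proof of measurability;
the existential form keeps that proof out of the statements that use it. *)
Lemma pushforward_measureP d d' (T1 : measurableType d) (T2 : measurableType d')
    (m : {measure set T1 -> \bar R}) (f : T1 -> T2) :
  measurable_fun [set: T1] f ->
  exists mu : {measure set T2 -> \bar R}, forall A, mu A = m (f @^-1` A).
Proof.
move=> mf.
by exists (measure_function_pushforward__canonical__measure_function_Measure m mf).
Qed.

Section SigmaFinite.
Context d (T : measurableType d) (mu : {measure set T -> \bar R}).
Hypothesis muT : sigma_finite setT mu.

Let nu : set T -> \bar R := mu.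
#[local] HB.instance Definition _ := Measure.on nu.
#[local] HB.instance Definition _ := Measure_isSigmaFinite.Build _ _ _ nu muT.

Lemma sigma_finite_measureP :
  exists nu : {sigma_finite_measure set T -> \bar R}, forall A, nu A = mu A.
Proof. by exists nu. Qed.

End SigmaFinite.

Lemma lebesgue_measure_shift (a : R) (E : set (measurableTypeR R)) :
  measurable E ->
  lebesgue_measure [set x : R | E (x + a)] = lebesgue_measure E.
Proof.
move=> mE.
have ma : measurable_fun [set: measurableTypeR R]
    ((fun x => x + a) : measurableTypeR R -> measurableTypeR R).
  by apply: measurable_realfun.measurable_funD; [exact: measurable_id|exact: measurable_cst].
have [mu muE] := pushforward_measureP lebesgue_measure ma.
rewrite -[LHS]/(lebesgue_measure ((fun x => x + a) @^-1` E)) -muE.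
apply/esym/lebesgue_measure_unique => // X [[b c]] _ <-; rewrite muE.
rewrite (_ : _ @^-1` _ = [set` `](b - a), (c - a)]]); last first.
  by apply/seteqP; split => x /=; rewrite !in_itv/= ltrBlDr lerBrDr.
rewrite /= !lebesgue_measure_itv/= !lte_fin.
rewrite ltrBlDr subrK -!EFinB.
by rewrite opprB addrA subrK.
Qed.

Lemma ge0_integral_lebesgue_shift (a : R) (f : measurableTypeR R -> \bar R) :
  measurable_fun [set: measurableTypeR R] f -> (forall x, 0 <= f x)%E ->
  (\int[@lebesgue_measure R]_x f (x + a)%R = \int[@lebesgue_measure R]_x f x)%E.
Proof.
move=> mf f0.
pose s := (fun x : R => x + a) : measurableTypeR R -> measurableTypeR R.
have ms : measurable_fun [set: measurableTypeR R] s.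
  by apply: measurable_realfun.measurable_funD;
    [exact: measurable_id|exact: measurable_cst].
have [mu muE] := pushforward_measureP lebesgue_measure ms.
have {}muE : (mu : set _ -> \bar R) = pushforward lebesgue_measure s.
  by apply/funext => A; rewrite muE.
transitivity (\int[mu]_x f x)%E.
  by rewrite muE (ge0_integral_pushforward ms).
apply: eq_measure_integral => A mA _.
by rewrite muE; exact: lebesgue_measure_shift.
Qed.

(** The recursion defining Lebesgue measure splits off the first coordinate;
this is the inverse of that splitting. *)
Definition consr m (z : measurableTypeR R * borel 'rV[R]_m) : borel 'rV[R]_m.+1 :=
  row_mx (z.1%:M : 'rV[R]_1) z.2.
Arguments consr : clear implicits.

Lemma consrE m (x : R) (v : 'rV[R]_m) (i : 'I_m.+1) :
  consr m (x, v) 0 i = if unlift ord0 i is Some j then v 0 j else x.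
Proof.
rewrite /consr /= (mxE _ _ 0 i) /=.
case: (unliftP ord0 i) => [j ->|->].
  have -> : lift ord0 j = rshift 1 j by apply/val_inj.
  by rewrite (unsplitK (inr _ : 'I_1 + 'I_m)).
have -> : @ord0 m = lshift m (ord0 : 'I_1) by apply/val_inj.
by rewrite (unsplitK (inl _ : 'I_1 + 'I_m)) !mxE.
Qed.

Lemma consr0 m (x : R) (v : 'rV[R]_m) : consr m (x, v) 0 ord0 = x.
Proof. by rewrite consrE unlift_none. Qed.

Lemma consrS m (x : R) (v : 'rV[R]_m) j : consr m (x, v) 0 (lift ord0 j) = v 0 j.
Proof. by rewrite consrE liftK. Qed.

Lemma consrD m (x y : R) (v w : 'rV[R]_m) :
  consr m (x, v) + consr m (y, w) = consr m (x + y, v + w) :> 'rV[R]_m.+1.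
Proof.
by apply/rowP => i; rewrite mxE !consrE; case: unliftP => [j _|_] //; rewrite mxE.
Qed.

Lemma ball_consr m (x y : R) (v w : 'rV[R]_m) (e : R) : 0 < e ->
  ball (consr m (x, v) : 'rV[R]_m.+1) e (consr m (y, w)) <->
  ball x e y /\ ball v e w.
Proof.
move=> e0; split.
- move=> [_ h]; split; first by have := h 0 ord0; rewrite !consr0.
  by split=> // i j; rewrite (ord1 i); have := h 0 (lift ord0 j); rewrite !consrS.
- move=> [xy [_ vw]]; split=> // i j; rewrite (ord1 i) !consrE.
  by case: unliftP => [k _|_]; [exact: vw | exact: xy].
Qed.

Lemma consr_surj m (u : 'rV[R]_m.+1) :
  u = consr m (u 0 ord0, \row_j u 0 (lift ord0 j)).
Proof.
apply/rowP => i; rewrite consrE; case: unliftP => [j ->|->] //.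
by rewrite mxE.
Qed.

(** An open set of the product is the union, over the countably many intervals
with rational ends, of the rectangles over that interval that it contains. *)
Lemma measurable_consr m : measurable_fun setT (consr m).
Proof.
apply: (@measurability _ _ _ (borel 'rV[R]_m.+1) setT (consr m)
  (@open 'rV[R]_m.+1)) => //.
move=> _ [W oW <-]; rewrite setTI.
pose V (ab : rat * rat) := [set v : 'rV[R]_m |
  forall x : R, ratr ab.1 < x < ratr ab.2 -> W (consr m (x, v))].
rewrite (_ : _ @^-1` _ = \bigcup_(ab : rat * rat)
   ([set` `](ratr ab.1 : R), (ratr ab.2)[] `*` (V ab)°)).
  apply: countable_bigcupT_measurable => //.
  move=> ab; apply: measurableX; first exact: measurable_itv.
  by apply: sub_sigma_algebra; exact: open_interior.
apply/seteqP; split => [[x v] /= Wxv|[x v] [[a b] _] [/=]]; last first.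
  by rewrite in_itv/= => axb /interior_subset; apply.
have : nbhs (consr m (x, v) : 'rV[R]_m.+1) W by apply: open_nbhs_nbhs; split.
move=> /nbhs_ballP[e /= e0 eW].
have /rat_in_itvoo[a] : x - e < x by rewrite ltrBlDr ltrDl.
rewrite in_itv/= => /andP[xa ax].
have /rat_in_itvoo[b] : x < x + e by rewrite ltrDl.
rewrite in_itv/= => /andP[xb bx].
exists (a, b) => //; split => /=; first by rewrite in_itv/= ax.
apply/nbhs_ballP; exists e => // w vw y /andP[ay yb]; apply: eW; apply/ball_consr => //; split => //.
by rewrite /ball/= ltr_norml; apply/andP; split; lra.
Qed.

Lemma lebesgue_rVS m (E : set (borel 'rV[R]_m.+1)) :
  lebesgue_rV E =
  (\int[@lebesgue_measure R]_x
     lebesgue_rV (xsection (consr m @^-1` E) x : set (borel 'rV[R]_m)))%E.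
Proof.
by apply: eq_integral => x _; congr (lebesgue_rV _);
  apply/seteqP; split => v /=; rewrite /xsection/= inE.
Qed.

Lemma ball_rV0 (y : 'rV[R]_0) (e : R) : 0 < e -> ball y e = setT.
Proof. by move=> e0; apply/seteqP; split => // z _; split => // i []. Qed.

(** The last clause, besides its use for volumes, supplies the sigma-finiteness
that the product with the next coordinate requires. *)
Lemma lebesgue_rV_measure m :
  exists mu : {sigma_finite_measure set (borel 'rV[R]_m) -> \bar R},
    (forall E, measurable E -> mu E = lebesgue_rV E) /\
    (forall (y : 'rV[R]_m) (e : R), 0 < e -> mu (ball y e) = ((e *+ 2) ^+ m)%:E).
Proof.
elim: m => [|m [mu [muE mu_ball]]].
  pose d : {measure set (borel 'rV[R]_0) -> \bar R} := \d_(0 : borel 'rV[R]_0).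
  have dT : sigma_finite setT d.
    apply: fin_num_fun_sigma_finite; first by rewrite measure0.
    by move=> A mA; rewrite /d/= diracE.
  have [mu muE] := sigma_finite_measureP dT.
  exists mu; split => [E mE|y e e0]; rewrite muE ?diracE ?indicE//.
  by rewrite ball_rV0// expr0; exact: diracT.
have [nu nuE] := pushforward_measureP (lebesgue_measure \x mu)%E
  (@measurable_consr m).
have nu_ball (y : 'rV[R]_m.+1) e : 0 < e -> nu (ball y e) = ((e *+ 2) ^+ m.+1)%:E.
  move=> e0; rewrite nuE (consr_surj y).
  set x := y _ _; set v := \row_j _.
  pose X : set (measurableTypeR R) := ball x e.
  pose V : set (borel 'rV[R]_m) := ball v e.
  rewrite (_ : _ @^-1` _ = X `*` V); last first.
    by apply/seteqP; split => -[z w]/= /ball_consr; apply.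
  transitivity (@lebesgue_measure R X * mu V)%E; last first.
  - by rewrite mu_ball// lebesgue_measure_ball ?(ltW e0)// -EFinM -exprS.
  - apply: product_measure1E; first exact: measurable_ball.
    by apply: sub_sigma_algebra; exact: ball_open.
have nuT : sigma_finite setT nu.
  exists (fun k => ball (0 : 'rV[R]_m.+1) k.+1%:R).
    apply/esym/seteqP; split => // v _.
    exists (Num.truncn `|v|) => //=.
    by rewrite mx_norm_ball /ball_/= sub0r normrN; exact: truncnS_gt.
  move=> k; split; first by apply: sub_sigma_algebra; exact: ball_open.
  by rewrite nu_ball// ltry.
have [nu' nu'E] := sigma_finite_measureP nuT.
exists nu'; split => [E mE|y e e0]; rewrite nu'E; last exact: nu_ball.
rewrite lebesgue_rVS nuE; apply: eq_integral => x _ /=.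
rewrite muE//; apply: measurable_xsection.
by rewrite -[X in measurable X]setTI; exact: measurable_consr.
Qed.

Lemma lebesgue_rV_shift m (a : 'rV[R]_m) (E : set (borel 'rV[R]_m)) :
  measurable E ->
  lebesgue_rV ([set y : 'rV[R]_m | E (y + a)] : set (borel 'rV[R]_m)) =
  lebesgue_rV E.
Proof.
elim: m a E => [|m IH] a E mE.
  congr (lebesgue_rV _); apply/seteqP.
  by split => y /=; rewrite [a]thinmx0 addr0.
rewrite !lebesgue_rVS (consr_surj a); set x := a _ _; set v := \row_j _.
have mE' : measurable (consr m @^-1` E).
  by rewrite -[X in measurable X]setTI; exact: measurable_consr.
have [mu [muE _]] := lebesgue_rV_measure m.
pose f (y : measurableTypeR R) := mu (xsection (consr m @^-1` E) y).
have fE y : f y = lebesgue_rV (xsection (consr m @^-1` E) y).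
  by rewrite /f muE//; exact: measurable_xsection.
transitivity (\int[@lebesgue_measure R]_y f (y + x)%R)%E.
  apply: eq_integral => y _; rewrite fE -[RHS](IH v); last exact: measurable_xsection.
  congr (lebesgue_rV _); apply/seteqP; split => w /=; rewrite /xsection/= !inE/=.
  - by rewrite consrD.
  - by rewrite consrD.
rewrite ge0_integral_lebesgue_shift//.
- by apply: eq_integral => y _; rewrite fE.
- exact: measurable_fun_xsection.
Qed.

End LebesgueMeasure.

(** * Functions of class C^1 *)

Section DirectionalDerivatives.
Variable R : realType.

Lemma mx_norm_entry m n (A : 'M[R]_(m, n)) i j : `|A i j| <= `|A|.
Proof.
rewrite [leRHS]/Num.norm/= mx_normrE.
by apply: (le_bigmax_cond _ (fun ij => `|A ij.1 ij.2|) (j := (i, j))).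
Qed.

Lemma mx_norm_le m n (A : 'M[R]_(m, n)) (e : R) : 0 <= e ->
  (forall i j, `|A i j| <= e) -> `|A| <= e.
Proof.
move=> e0 Ae; rewrite [leLHS]/Num.norm/= mx_normrE.
by apply/bigmax_leP; split => // -[i j] _; exact: Ae.
Qed.

Lemma is_derive_line (V : normedModType R) (f : V -> R) (y v : V) (s : R) :
  derivable f (s *: v + y) v ->
  is_derive s 1 (fun a : R => f (a *: v + y)) ('D_v f (s *: v + y)).
Proof.
move=> df.
have E : (fun h : R => h^-1 *: (((fun a : R => f (a *: v + y)) \o shift s) (h *: 1)
      - f (s *: v + y))) =
    (fun h : R => h^-1 *: ((f \o shift (s *: v + y)) (h *: v) - f (s *: v + y))).
  by apply/funext => h /=; rewrite [_%:A]mulr1 scalerDl addrA.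
by split; [rewrite /derivable E|rewrite /derive E].
Qed.

Lemma is_derive_affine (V : normedModType R) (w y : V) (s : R) :
  is_derive s (1 : R) (fun a : R => a *: w + y) w.
Proof.
have E : (fun h : R => h^-1 *: (((fun a : R => a *: w + y) \o shift s) (h *: (1 : R))
    - (s *: w + y))) @ (0 : R)^' --> w.
  apply: cvg_near_cst; near=> h.
  have h0 : h != 0 by near: h; exact: nbhs_dnbhs_neq.
  by rewrite /= [_%:A]mulr1 scalerDl -[_ + _ + y]addrA addrK scalerA mulVf// scale1r.
by split; [apply/cvg_ex; exists w|exact: cvg_lim].
Unshelve. all: by end_near. Qed.

Lemma mean_value_line (V : normedModType R) (f : V -> R) (y v : V) :
  (forall s, 0 <= s <= 1 -> derivable f (s *: v + y) v) ->
  exists2 s, 0 <= s <= 1 & f (v + y) - f y = 'D_v f (s *: v + y).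
Proof.
move=> df.
have [s||s s01] := @MVT R (fun a => f (a *: v + y)) (fun a => 'D_v f (a *: v + y))
  0 1 ltr01.
- by rewrite in_itv/= => /andP[/ltW s0 /ltW s1]; apply/is_derive_line/df/andP.
- apply: derivable_within_continuous => s; rewrite in_itv/= => s01.
  by have [] := is_derive_line (df s s01).
rewrite scale1r scale0r add0r subr0 mulr1 => ->; exists s => //.
by move: s01; rewrite in_itv/= => /andP[/ltW-> /ltW->].
Qed.

Lemma is_derive_scale (V : normedModType R) (f : V -> R) (x v : V) (a : R) :
  derivable f x v -> is_derive x (a *: v) f (a * 'D_v f x).
Proof.
move=> df.
have dl : is_derive (0 : R) 1 (fun s : R => f (s *: v + x)) ('D_v f x).
  by have := @is_derive_line V f x v 0; rewrite scale0r add0r => /(_ df).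
have dd : differentiable (fun s : R => f (s *: v + x)) 0.
  by apply/derivable1_diffP; case: dl.
have da : is_derive (0 : R) a (fun s : R => f (s *: v + x)) (a * 'D_v f x).
  split; first exact: diff_derivable.
  have [_ <-] := dl; rewrite !deriveE// -[a in LHS]mulr1.
  by rewrite -[a * 1]/(a *: (1 : R)) linearZ.
have E : (fun h : R => h^-1 *: ((f \o shift x) (h *: (a *: v)) - f x)) =
    (fun h : R => h^-1 *: (((fun s : R => f (s *: v + x)) \o shift 0) (h *: a)
      - f (0 *: v + x))).
  by apply/funext => h /=; rewrite addr0 scale0r add0r scalerA.
by case: da => ? ?; split; [rewrite /derivable E|rewrite /derive E].
Qed.

Section DotProduct.
Variables (m : nat) (d : 'I_m -> R).

(** As a map of h this is the candidate differential with partial derivatives d,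
made a linear structure below. *)
Definition dotv (h : 'rV[R]_m) : R := \sum_(i < m) h 0 i * d i.

Lemma dotv_is_linear : linear_for ( *:%R : R -> R -> R) dotv.
Proof.
move=> a u v; rewrite /dotv [a *: (\sum_(_ < _) _)]mulr_sumr -big_split/=; apply: eq_bigr => i _.
by rewrite !mxE mulrDl mulrA.
Qed.

HB.instance Definition _ := GRing.isLinear.Build R 'rV[R]_m R _ dotv dotv_is_linear.

Lemma dotv_le h : `|dotv h| <= (\sum_(i < m) `|d i|) * `|h|.
Proof.
rewrite (le_trans (ler_norm_sum _ _ _))// mulr_suml ler_sum// => i _.
by rewrite normrM mulrC ler_wpM2l// mx_norm_entry.
Qed.

Lemma continuous_dotv : continuous dotv.
Proof.
apply/linear_bounded_continuous/linear_boundedP.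
exists (\sum_(i < m) `|d i|); split; first exact: num_real.
by move=> r /ltW dr x; rewrite (le_trans (dotv_le x))// ler_wpM2r.
Qed.

End DotProduct.

Lemma differentiable_littleo m (f : 'rV[R]_m -> R) x (d : 'I_m -> R) :
  (forall e, 0 < e ->
    \forall h \near (0 : 'rV[R]_m), `|f (h + x) - f x - dotv d h| <= e * `|h|) ->
  differentiable f x.
Proof.
move=> fo; apply/diffP => /=.
apply: (@getPex _ (fun (df : {linear 'rV[R]_m -> R}) => continuous df /\
  forall y, f y = f (lim (nbhs x)) + df (y - lim (nbhs x))
                  +o_(y \near x) (y - lim (nbhs x)))).
exists (dotv d : {linear _ -> _}); split; first exact: continuous_dotv.
rewrite lim_id//.
have fE : f = (fun y => f x + dotv d (y - x)) +o_x (fun y => y - x).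
  apply/eqaddoP => e e0; have /nbhs_ballP[r /= r0 fr] := fo e e0.
  apply/nbhs_ballP; exists r => // y xy /=.
  have := fr (y - x); rewrite subrK !fctE opprD addrA; apply.
  by move: xy; rewrite -!ball_normE /ball_/= sub0r normrN distrC.
by move=> y; exact: (congr1 (fun F => F y) fE).
Qed.

(** The increment from x to x + h is cut into steps along the axes, and the mean
value theorem applies to each step. *)
Lemma differentiable_C1 m (U : set 'rV[R]_m) (f : 'rV[R]_m -> R) x :
  nbhs x U -> (forall i y, U y -> derivable f y (delta_mx 0 i)) ->
  (forall i, {for x, continuous (partial i f)}) -> differentiable f x.
Proof.
move=> Ux df cf; apply: (@differentiable_littleo _ _ _ (fun i => partial i f x)).
move=> e e0.
pose e' := e / m.+1%:R.
have e'0 : 0 < e' by rewrite divr_gt0// ltr0Sn.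
have [r r0 fr] : exists2 r, 0 < r & forall y, `|y - x| < r ->
    U y /\ forall i, `|partial i f y - partial i f x| <= e'.
  have : \forall y \near x, U y /\ forall i, `|partial i f y - partial i f x| <= e'.
    near=> y; split; first by near: y.
    near: y; apply: filter_forall => i.
    by have /cvgrPdist_le/(_ _ e'0) := cf i; apply: filterS => y; rewrite distrC.
  move=> /nbhs_ballP[r /= r0 xr]; exists r => // y xy; apply: xr.
  by rewrite -ball_normE /ball_/= distrC.
pose tr k (h : 'rV[R]_m) := \row_(j < m) (if (j < k)%N then h 0 j else 0).
apply/nbhs_ballP; exists r => // h; rewrite -ball_normE /ball_/= sub0r normrN => hr.
have tr0 : tr 0 h = 0 by apply/rowP => j; rewrite !mxE.
have trm : tr m h = h by apply/rowP => j; rewrite !mxE ltn_ord.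
have trS (k : 'I_m) : tr k.+1 h = h 0 k *: delta_mx 0 k + tr k h.
  apply/rowP => j; rewrite !mxE eqxx/= ltnS leq_eqVlt -val_eqE/=.
  by case: (ltngtP j k) => //= jk; rewrite ?mulr0 ?add0r// mulr1 addr0; congr (h 0 _); apply/val_inj.
have step (k : 'I_m) : `|f (tr k.+1 h + x) - f (tr k h + x)
    - h 0 k * partial k f x| <= e' * `|h|.
  have near_x s : 0 <= s <= 1 ->
      `|s *: (h 0 k *: delta_mx 0 k) + (tr k h + x) - x| < r.
    move=> /andP[s0 s1]; rewrite addrA addrK (le_lt_trans _ hr)//.
    apply: mx_norm_le => // i j; rewrite !mxE (ord1 i) eqxx/= -val_eqE/=.
    case: (ltngtP j k) => jk /=; rewrite ?mulr0 ?add0r ?mx_norm_entry//.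
      by rewrite normr0.
    rewrite mulr1 addr0 normrM ger0_norm//.
    by rewrite (le_trans (ler_piMl _ s1))// mx_norm_entry.
  have dk s : 0 <= s <= 1 -> derivable f
      (s *: (h 0 k *: delta_mx 0 k) + (tr k h + x)) (delta_mx 0 k).
    by move=> s01; apply: df; have [] := fr _ (near_x s s01).
  have [|s s01] := @mean_value_line _ f (tr k h + x) (h 0 k *: delta_mx 0 k).
    by move=> s s01; case: (is_derive_scale (h 0 k) (dk s s01)).
  rewrite addrA -trS => ->.
  have [_ ->] := is_derive_scale (h 0 k) (dk s s01).
  rewrite -mulrBr normrM mulrC ler_pM// ?mx_norm_entry//.
  by have [_] := fr _ (near_x s s01); exact.
rewrite (_ : f (h + x) - f x = \sum_(k < m) (f (tr k.+1 h + x) - f (tr k h + x))).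
  rewrite /dotv -sumrB (le_trans (ler_norm_sum _ _ _))//.
  rewrite (le_trans (ler_sum _ (fun k _ => step k)))// sumr_const card_ord.
  rewrite -mulrnAl ler_wpM2r// /e' -mulr_natr -mulrA ler_piMr ?(ltW e0)//.
  by rewrite mulrC ler_pdivrMr ?ltr0Sn// mul1r ler_nat.
rewrite -(big_mkord xpredT (fun k => f (tr k.+1 h + x) - f (tr k h + x))).
by rewrite telescope_sumr// trm tr0 add0r.
Unshelve. all: by end_near. Qed.

Lemma derive_dotv m (f : 'rV[R]_m -> R) x v : differentiable f x ->
  'D_v f x = dotv (fun i => partial i f x) v.
Proof.
move=> df; rewrite deriveE// [v in LHS]row_sum_delta linear_sum/=.
by apply: eq_bigr => i _; rewrite linearZ/= /partial deriveE.
Qed.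

Lemma continuous_near_eq (T U : topologicalType) (f g : T -> U) x :
  (\forall y \near x, f y = g y) -> {for x, continuous g} -> {for x, continuous f}.
Proof.
move=> fg cg; rewrite /prop_for /continuous_at (nbhs_singleton fg).
by apply: cvg_trans cg; apply: near_eq_cvg; apply: filterS fg => y ->.
Qed.

Lemma continuous_at_sum (T : topologicalType) (I : Type) (s : seq I)
    (F : I -> T -> R) x :
  (forall i, {for x, continuous (F i)}) ->
  {for x, continuous (fun y => \sum_(i <- s) F i y)}.
Proof.
move=> cF; apply: cvg_big => [|i _]; first exact: add_continuous.
exact: cF.
Qed.

Lemma continuous_at_prod (T : topologicalType) (I : Type) (s : seq I)
    (F : I -> T -> R) x :
  (forall i, {for x, continuous (F i)}) ->
  {for x, continuous (fun y => \prod_(i <- s) F i y)}.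
Proof.
move=> cF; apply: cvg_big => [|i _]; first exact: mul_continuous.
exact: cF.
Qed.

Definition C1_on m (U : set 'rV[R]_m) (f : 'rV[R]_m -> R) : Prop :=
  forall x, U x -> differentiable f x /\
    forall v, {for x, continuous (fun y => 'D_v f y)}.

Lemma smooth_on_C1 m (U : set 'rV[R]_m) f : open U -> smooth_on U f -> C1_on U f.
Proof.
move=> oU /(_ 1) [_ sf] x Ux; split; last by move=> v; have [_ [+ _]] := sf v; apply.
apply: (@differentiable_C1 _ U) => [|i y Uy|i].
- exact: open_nbhs_nbhs.
- by have [+ _] := sf (delta_mx 0 i); apply.
- by have [_ [+ _]] := sf (delta_mx 0 i); apply.
Qed.

Lemma near_eq_differentiable m (f g : 'rV[R]_m -> R) x :
  (\forall y \near x, f y = g y) -> differentiable g x -> differentiable f x.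
Proof.
move=> fg dg; apply: (@differentiable_littleo _ _ _ (fun i => partial i g x)).
move=> e e0.
have [_ /eqaddoP /(_ e e0)] := (diff_locallyP _ _).1 dg.
have : \forall h \near (0 : 'rV[R]_m), f (h + x) = g (h + x).
  by move: fg; rewrite (near_shift 0 x)/= subr0.
apply: filterS2 => h fgh; rewrite !fctE/= fgh (nbhs_singleton fg) opprD addrA.
by rewrite -derive_dotv// deriveE.
Qed.

Lemma C1_on_near m (U : set 'rV[R]_m) (f g : 'rV[R]_m -> R) :
  (forall x, U x -> \forall y \near x, f y = g y) -> C1_on U g -> C1_on U f.
Proof.
move=> fg Cg x Ux; have [dg cg] := Cg x Ux; split.
  exact: near_eq_differentiable (fg x Ux) dg.
move=> v; apply: continuous_near_eq (cg v).
have /near_join := fg x Ux; apply: filterS => y.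
exact: near_eq_derive.
Qed.

Lemma C1_on_cst m (U : set 'rV[R]_m) (c : R) : C1_on U (cst c).
Proof.
move=> x _; split; first exact: differentiable_cst.
move=> v; apply: (@continuous_near_eq _ _ _ (cst 0)); last exact: cst_continuous.
by near=> y; rewrite derive_cst.
Unshelve. all: by end_near. Qed.

Lemma C1_onD m (U : set 'rV[R]_m) (f g : 'rV[R]_m -> R) : open U ->
  C1_on U f -> C1_on U g -> C1_on U (f \+ g).
Proof.
move=> oU Cf Cg x Ux; have [df cf] := Cf x Ux; have [dg cg] := Cg x Ux; split.
  exact: differentiableD.
move=> v; apply: (@continuous_near_eq _ _ _ (fun y => 'D_v f y + 'D_v g y)).
  apply: filterS (open_nbhs_nbhs (conj oU Ux)) => y Uy.
  by rewrite deriveD//; apply: diff_derivable; [have [] := Cf y Uy|have [] := Cg y Uy].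
by apply: continuousD; [exact: cf|exact: cg].
Qed.

Lemma C1_onM m (U : set 'rV[R]_m) (f g : 'rV[R]_m -> R) : open U ->
  C1_on U f -> C1_on U g -> C1_on U (f \* g).
Proof.
move=> oU Cf Cg x Ux; have [df cf] := Cf x Ux; have [dg cg] := Cg x Ux; split.
  exact: differentiableM.
move=> v; apply: (@continuous_near_eq _ _ _
    (fun y => f y * 'D_v g y + g y * 'D_v f y)).
  apply: filterS (open_nbhs_nbhs (conj oU Ux)) => y Uy.
  by rewrite deriveM//; apply: diff_derivable; [have [] := Cf y Uy|have [] := Cg y Uy].
apply: continuousD; apply: continuousM; [|exact: cg| |exact: cf];
  exact: differentiable_continuous.
Qed.

Lemma C1_on_sum m (U : set 'rV[R]_m) (I : Type) (s : seq I) (F : I -> 'rV[R]_m -> R) :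
  open U -> (forall i, C1_on U (F i)) -> C1_on U (fun x => \sum_(i <- s) F i x).
Proof.
move=> oU CF; elim: s => [|i s IH].
  by under eq_fun do rewrite big_nil; exact: C1_on_cst.
under eq_fun do rewrite big_cons.
exact: C1_onD.
Qed.

Lemma is_derive_comp m (f : 'rV[R]_m -> R) (p : R -> R) x v :
  differentiable f x -> derivable p (f x) 1 ->
  differentiable (p \o f) x /\ 'D_v (p \o f) x = derive1 p (f x) * 'D_v f x.
Proof.
move=> df /derivable1_diffP dp; split; first exact: differentiable_comp.
rewrite !deriveE//; last exact: differentiable_comp.
rewrite diff_comp//= derive1E deriveE//.
rewrite -[X in 'd p _ X = _]mulr1 -[X in 'd p _ X = _]/('d f x v *: (1 : R)).
by rewrite linearZ/= mulrC.
Qed.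

Lemma C1_on_comp m (U : set 'rV[R]_m) (f : 'rV[R]_m -> R) (p : R -> R) : open U ->
  C1_on U f ->
  (forall x, U x -> derivable p (f x) 1 /\ {for f x, continuous (derive1 p)}) ->
  C1_on U (p \o f).
Proof.
move=> oU Cf Cp x Ux; have [df cf] := Cf x Ux; have [dp cp] := Cp x Ux; split.
  by have [] := is_derive_comp 0 df dp.
move=> v; apply: (@continuous_near_eq _ _ _ (fun y => derive1 p (f y) * 'D_v f y)).
  apply: filterS (open_nbhs_nbhs (conj oU Ux)) => y Uy.
  by have [] := @is_derive_comp _ f p y v; have [] := Cf y Uy; have [] := Cp y Uy.
apply: continuousM; last exact: cf.
by apply: continuous_comp => //; exact: differentiable_continuous.
Qed.

Lemma differentiable_row m n (t : 'rV[R]_m -> 'rV[R]_n) x :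
  (forall k, differentiable (fun y => t y 0 k) x) -> differentiable t x.
Proof.
move=> dt.
rewrite (_ : t = \sum_(k < n) (fun y => t y 0 k *: delta_mx 0 k)).
  by apply/differentiable_sum => k; exact: differentiableZl.
by apply/funext => y; rewrite fct_sumE; exact: row_sum_delta.
Qed.

Lemma is_derive_map m n (t : 'rV[R]_m -> 'rV[R]_n) (b : 'rV[R]_n -> R) x v :
  (forall k, differentiable (fun y => t y 0 k) x) -> differentiable b (t x) ->
  differentiable (b \o t) x /\
  'D_v (b \o t) x = 'D_(\row_k 'D_v (fun y => t y 0 k) x) b (t x).
Proof.
move=> dt db.
have dt' := differentiable_row dt.
split; first exact: differentiable_comp.
rewrite !deriveE//; last exact: differentiable_comp.
rewrite diff_comp//=; congr ('d b _ _).
rewrite -deriveE// derive_mx; last exact: diff_derivable.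
by apply/rowP => k; rewrite !mxE.
Qed.

Lemma C1_on_map m n (U : set 'rV[R]_m) (W : set 'rV[R]_n)
    (t : 'rV[R]_m -> 'rV[R]_n) (b : 'rV[R]_n -> R) : open U ->
  (forall k, C1_on U (fun y => t y 0 k)) -> C1_on W b ->
  (forall x, U x -> W (t x)) -> C1_on U (b \o t).
Proof.
move=> oU Ct Cb UW x Ux; have [db cb] := Cb (t x) (UW x Ux); split.
  by have [] := @is_derive_map _ _ t b x 0 (fun k => (Ct k x Ux).1) db.
move=> v; apply: (@continuous_near_eq _ _ _ (fun y => \sum_(k < n)
    'D_v (fun y => t y 0 k) y * partial k b (t y))).
  apply: filterS (open_nbhs_nbhs (conj oU Ux)) => y Uy.
  have [db' _] := Cb (t y) (UW y Uy).
  have [_ ->] := @is_derive_map _ _ t b y v (fun k => (Ct k y Uy).1) db'.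
  by rewrite derive_dotv//; apply: eq_bigr => k _; rewrite mxE.
apply: continuous_at_sum => k.
apply: continuousM; first exact: (Ct k x Ux).2.
apply: continuous_comp; last exact: cb.
apply: differentiable_continuous; apply: differentiable_row => k'.
exact: (Ct k' x Ux).1.
Qed.

End DirectionalDerivatives.

(** * Integration by parts *)

Section IntegrationByParts.
Variable R : realType.

Import HBNNSimple.

(** The iterated integral defining Lebesgue measure is additive only on Borel
sets, and integrals against it only see its values there. *)
Lemma eq_setfun_integral d (T : measurableType d) (mu : {measure set T -> \bar R})
    (nu : set T -> \bar R) (D : set T) (f : T -> \bar R) :
  (forall E, measurable E -> mu E = nu E) ->
  (\int[nu]_(x in D) f x = \int[mu]_(x in D) f x)%E.
Proof.
move=> muE; rewrite /integral.
have E (h : T -> \bar R) :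
    [set sintegral nu k | k in [set k : {nnsfun T >-> R} | forall x, ((k x)%:E <= h x)%E]] =
    [set sintegral mu k | k in [set k : {nnsfun T >-> R} | forall x, ((k x)%:E <= h x)%E]].
  have kE (k : {nnsfun T >-> R}) : sintegral nu k = sintegral mu k.
    by apply: eq_fsbigr => r _; rewrite muE.
  by apply/seteqP; split => _ [k kh <-]; exists k => //; rewrite kE.
by rewrite !E.
Qed.

(** The integral is a difference of suprema over simple functions, hence is
monotone even where measurability is unknown. *)
Lemma le_integral_pointwise d (T : measurableType d) (mu : {measure set T -> \bar R})
    (D : set T) (f h : T -> \bar R) :
  (forall x, D x -> (f x <= h x)%E) ->
  (\int[mu]_(x in D) f x <= \int[mu]_(x in D) h x)%E.
Proof.
move=> fh; have fhD x : ((f \_ D) x <= (h \_ D) x)%E.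
  by rewrite /patch; case: ifPn => // /[!inE] /fh.
rewrite /integral; apply: leeB; apply: le_ereal_sup => _ [k kle <-]; exists k => // x;
  apply: le_trans (kle x) _.
- by apply: (@funepos_le _ _ setT) => [y _|]; [exact: fhD|rewrite inE].
- by apply: (@funeneg_le _ _ setT) => [y _|]; [exact: fhD|rewrite inE].
Qed.

Lemma borel_continuous_measurable (T : ptopologicalType) (D : set T) (f : T -> R) :
  open D -> (forall x, D x -> {for x, continuous f}) ->
  measurable_fun (D : set (borel T)) (f : borel T -> R).
Proof.
move=> oD cf; apply: (measurability _ (RGenOpens.measurableE R)).
move=> _ [_ [a [b ->] <-]]; apply: sub_sigma_algebra.
rewrite openE => x [/= Dx fx]; apply: filterI.
  exact: open_nbhs_nbhs.
by apply: (cf x Dx); apply: open_nbhs_nbhs; split => //; exact: interval_open.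
Qed.

Lemma continuous_addr (V : normedModType R) (a : V) : continuous (fun y => y + a).
Proof. by move=> y; apply: cvgD; [exact: cvg_id|exact: cvg_cst]. Qed.

Lemma continuous_scaled_diff (T : topologicalType) (c : R) (f g : T -> R) :
  continuous f -> continuous g -> continuous (fun y => c * (f y - g y)).
Proof.
by move=> cf cg y; apply: cvgM; [exact: cvg_cst|apply: cvgB; [exact: cf|exact: cg]].
Qed.

Lemma near_outside_ball m (M : R) (y : 'rV[R]_m) :
  M < `|y| -> \forall z \near y, M < `|z|.
Proof. by move=> My; exact: (cvgr_gt `|y| (@norm_continuous _ _ y)). Qed.

Lemma continuous_supp_bounded m (a : 'rV[R]_m -> R) (M : R) : continuous a ->
  (forall y, M < `|y| -> a y = 0) -> exists C, forall y, `|a y| <= C.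
Proof.
move=> ca a0.
have cB : compact [set y : 'rV[R]_m | `|y| <= M].
  apply: bounded_closed_compact.
    by exists M; split; [exact: num_real|move=> N /ltW MN y /= /le_trans]; apply.
  rewrite (_ : mkset _ = (fun y : 'rV[R]_m => `|y|) @^-1` [set r | r <= M]) //.
  by apply: closed_comp => [y _|]; [exact: norm_continuous|exact: closed_le].
have cna : continuous (fun y => `|a y|).
  by move=> y; apply: continuous_comp; [exact: ca|exact: norm_continuous].
have [[y yM]|noy] := pselect ([set y : 'rV[R]_m | `|y| <= M] !=set0).
  have [||c _ cmax] := @EVT_max_rV R m (fun y => `|a y|) _ _ cB.
  - by exists y.
  - exact: continuous_subspaceT.
  exists `|a c| => z; have [zM|Mz] := leP `|z| M; first by apply: cmax; rewrite inE.
  by rewrite a0// normr0.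
exists 0 => z; rewrite a0 ?normr0// ltNge; apply/negP => zM.
by apply: noy; exists z.
Qed.

Section Lebesgue.
Variables (m : nat) (mu : {measure set (borel 'rV[R]_m) -> \bar R}).
Hypothesis muE : forall E, measurable E -> mu E = lebesgue_rV E.
Hypothesis mu_ball : forall (y : 'rV[R]_m) (e : R), 0 < e ->
  mu (ball y e) = ((e *+ 2) ^+ m)%:E.

Let B (M : R) : set (borel 'rV[R]_m) := ball (0 : 'rV[R]_m) M.

Let indicB (M : R) (y : 'rV[R]_m) : `|y| < M -> \1_(B M) y = 1 :> R.
Proof. by move=> yM; rewrite indicE mem_set// /B -ball_normE /ball_/= sub0r normrN. Qed.

Lemma indic_ball_integrable (M C : R) : 0 < M ->
  mu.-integrable setT (fun y => (C * \1_(B M) y)%:E).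
Proof.
move=> M0.
have mB : measurable (B M) by apply: sub_sigma_algebra; exact: ball_open.
rewrite (_ : (fun y => _) = (fun y => C%:E * (\1_(B M) y)%:E)%E) //.
apply: integrableZl => //; apply/integrableP; split.
  by apply/measurable_EFinP; exact: measurable_indic.
rewrite (eq_integral (fun x => (\1_(B M) x)%:E)); last first.
  by move=> t _; rewrite gee0_abs// lee_fin.
rewrite integral_indic// setIT.
by apply: le_lt_trans (ltry ((M *+ 2) ^+ m)); rewrite mu_ball.
Qed.

Lemma continuous_supp_integrable (a : 'rV[R]_m -> R) (M : R) : continuous a ->
  (forall y, M < `|y| -> a y = 0) -> mu.-integrable setT (EFin \o a).
Proof.
move=> ca a0; have [C aC] := continuous_supp_bounded ca a0.
have M0 : 0 < `|M| + 1 by rewrite ltr_wpDl.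
apply: le_integrable (indic_ball_integrable C M0) => //.
  apply/measurable_EFinP; apply: borel_continuous_measurable; first exact: openT.
  by move=> y _; exact: ca.
move=> y _ /=; rewrite lee_fin.
have [yM|My] := ltP `|y| (`|M| + 1).
  rewrite indicB// mulr1.
  by rewrite (le_trans (aC y))// ler_norm.
by rewrite a0 ?normr0// (lt_le_trans _ My)// ltr_pwDr// ler_norm.
Qed.

Lemma integral_lebesgue_shift (f : 'rV[R]_m -> R) (a : 'rV[R]_m) (M : R) :
  continuous f -> (forall y, M < `|y| -> f y = 0) ->
  (\int[mu]_y (f (y + a))%:E = \int[mu]_y (f y)%:E)%E.
Proof.
move=> cf f0.
pose s := (fun y : 'rV[R]_m => y + a) : borel 'rV[R]_m -> borel 'rV[R]_m.
have cs : continuous (fun y : 'rV[R]_m => y + a) by exact: continuous_addr.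
have ms : measurable_fun [set: borel 'rV[R]_m] s.
  apply: (@measurability _ _ _ (borel 'rV[R]_m) setT s (@open 'rV[R]_m)) => //.
  move=> _ [W oW <-]; rewrite setTI; apply: sub_sigma_algebra.
  by move/continuousP : cs; exact.
have [nu nuE] := pushforward_measureP mu ms.
have {}nuE : (nu : set _ -> \bar R) = pushforward mu s by apply/funext => A; rewrite nuE.
have mf : measurable_fun [set: borel 'rV[R]_m] (EFin \o f : borel 'rV[R]_m -> \bar R).
  apply/measurable_EFinP; apply: borel_continuous_measurable; first exact: openT.
  by move=> y _; exact: cf.
transitivity (\int[nu]_y (f y)%:E)%E.
  rewrite nuE (integral_pushforward ms)//.
  apply: (@continuous_supp_integrable (f \o s) (`|M| + `|a|)).
    by move=> y; apply: continuous_comp; [exact: cs|exact: cf].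
  move=> y; rewrite /= /s => My; apply: f0; rewrite (le_lt_trans (ler_norm M))//.
  have := ler_normB (y + a) a; rewrite addrK; lra.
apply: eq_measure_integral => A mA _.
rewrite nuE /pushforward !muE//; first exact: lebesgue_rV_shift.
by rewrite -[X in measurable X]setTI; exact: ms.
Qed.

(** Translation invariance makes the integrals of all difference quotients
vanish; they converge boundedly to the derivative. *)
Lemma integral_derive_eq0 (F : 'rV[R]_m -> R) (v : 'rV[R]_m) (M : R) :
  continuous F -> (forall y, derivable F y v) ->
  continuous (fun y => 'D_v F y) -> (forall y, M < `|y| -> F y = 0) ->
  (\int[mu]_y ('D_v F y)%:E = 0)%E.
Proof.
move=> cF dF cdF F0.
have dF0 y : M < `|y| -> 'D_v F y = 0.
  move=> /near_outside_ball My; rewrite (@near_eq_derive _ _ _ _ (cst 0)).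
    exact: derive_cst.
  by apply: filterS My => z; exact: F0.
have [C dFC] := continuous_supp_bounded cdF dF0.
pose h k : R := k.+1%:R^-1.
have h0 k : 0 < h k by rewrite invr_gt0 ltr0Sn.
pose G k y := (h k)^-1 * (F (y + h k *: v) - F y).
have GE k y : exists z, G k y = 'D_v F z.
  have [s _|s _] := @mean_value_line _ _ F y (h k *: v).
    by case: (is_derive_scale (h k) (dF (s *: (h k *: v) + y))).
  case: (is_derive_scale (h k) (dF (s *: (h k *: v) + y))) => _ -> Fh.
  exists (s *: (h k *: v) + y); rewrite /G [y + _]addrC Fh mulrA mulVf ?mul1r//.
  by rewrite gt_eqF.
have GC k y : `|G k y| <= C by have [z ->] := GE k y.
pose N := `|M| + `|v| + 1.
have N0 : 0 < N by rewrite ltr_wpDl// addr_ge0.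
have G0 k y : N <= `|y| -> G k y = 0.
  move=> Ny; rewrite /G !F0 ?subrr ?mulr0//.
    by rewrite (le_lt_trans (ler_norm M))// (lt_le_trans _ Ny)// /N; have := normr_ge0 v; lra.
  have := ler_normB (y + h k *: v) (h k *: v); rewrite addrK normrZ.
  have : `|h k| * `|v| <= `|v|.
    by rewrite ler_piMl// ger0_norm ?(ltW (h0 k))// invf_le1// ?ler1n// ltr0Sn.
  by have := ler_norm M; rewrite /N in Ny *; lra.
have cFh k : continuous (fun y : 'rV[R]_m => F (y + h k *: v)).
  by move=> y; apply: continuous_comp; [exact: continuous_addr|exact: cF].
have cG k : continuous (G k) by exact: continuous_scaled_diff.
have IG k : (\int[mu]_y (G k y)%:E = 0)%E.
  have iF := continuous_supp_integrable cF F0.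
  have iFh : mu.-integrable setT (fun y => (F (y + h k *: v))%:E).
    apply: (@continuous_supp_integrable _ N (cFh k)) => y Ny.
    apply: F0; have := ler_normB (y + h k *: v) (h k *: v); rewrite addrK normrZ.
    have : `|h k| * `|v| <= `|v|.
      by rewrite ler_piMl// ger0_norm ?(ltW (h0 k))// invf_le1// ?ler1n// ltr0Sn.
    by have := ler_norm M; rewrite /N in Ny *; lra.
  transitivity (\int[mu]_y (((h k)^-1)%:E * ((F (y + h k *: v))%:E - (F y)%:E)))%E.
    by apply: eq_integral => y _; rewrite -EFinB -EFinM.
  rewrite integralZl//; last exact: integrableB.
  rewrite integralB// (integral_lebesgue_shift _ cF F0) subee ?mule0//.
  exact: integrable_fin_num.
have mG (a : 'rV[R]_m -> R) : continuous a ->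
    measurable_fun [set: borel 'rV[R]_m] (fun y => (a y)%:E).
  move=> ca; apply/measurable_EFinP.
  by apply: borel_continuous_measurable; [exact: openT|move=> y _; exact: ca].
have [|||||_ _] := @dominated_convergence _ _ _ mu setT measurableT
  (fun k y => (G k y)%:E) (fun y => ('D_v F y)%:E)
  (fun y => (C * \1_(B N) y)%:E).
- by move=> k; exact: (mG (G k) (cG k)).
- exact: (mG _ cdF).
- apply: aeW => y _ /=; apply: cvg_EFin; first exact: nearW.
  have hn : h k @[k --> \oo] --> (0 : R)^'.
    move=> A nA.
    have : \forall k \near \oo, h k != 0 -> A (h k) by exact: cvg_harmonic nA.
    by apply: filterS => k; apply; rewrite gt_eqF.
  have := cvg_comp _ _ hn (dF y).
  apply: cvg_trans; apply: near_eq_cvg; near=> k.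
  by rewrite /= /G [y + _]addrC.
- exact: indic_ball_integrable.
- apply: aeW => y k _; rewrite lee_fin; have [yN|Ny] := ltP `|y| N.
    by rewrite indicB// mulr1.
  by rewrite G0// normr0 mulr_ge0// (le_trans (normr_ge0 _) (GC k y)).
under eq_fun do rewrite IG.
by move=> /cvg_lim <-//; rewrite lim_cst.
Unshelve. all: by end_near. Qed.

End Lebesgue.

(** The product f phi extends by zero to a C^1 function with compact support on
the whole space, although f is only controlled on U. *)
Lemma integration_by_parts_rV m (U K : set 'rV[R]_m) (f phi : 'rV[R]_m -> R) v :
  open U -> C1_on U f -> C1_on setT phi -> compact K -> K `<=` U ->
  (forall y, ~ K y -> phi y = 0) ->
  (\int[@lebesgue_rV R m]_y (f y * 'D_v phi y)%:E =
   - \int[@lebesgue_rV R m]_y ('D_v f y * phi y)%:E)%E.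
Proof.
move=> oU Cf Cphi cK KU phi0.
have [mu [muE mu_ball]] := lebesgue_rV_measure R m.
rewrite !(eq_setfun_integral _ _ muE).
have oK : open (~` K).
  by apply: closed_openC; apply: compact_closed => //; exact: norm_hausdorff.
have phi_near y : ~ K y -> \forall z \near y, phi z = 0.
  by move=> Ky; apply: filterS (open_nbhs_nbhs (conj oK Ky)) => z; exact: phi0.
have dphi0 y : ~ K y -> 'D_v phi y = 0.
  by move=> /phi_near py; rewrite (near_eq_derive _ py) derive_cst.
have [M [_ KM]] := compact_bounded cK.
have suppM (a : 'rV[R]_m -> R) : (forall y, ~ K y -> a y = 0) ->
    forall y, M + 1 < `|y| -> a y = 0.
  move=> a0 y My; apply: a0 => Ky; move: My; rewrite ltNge => /negP; apply.
  by apply: (KM (M + 1)) => //; rewrite ltrDl.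
have cU (a : 'rV[R]_m -> R) : (forall y, U y -> {for y, continuous a}) ->
    (forall y, ~ K y -> a y = 0) -> continuous a.
  move=> ca a0 y; have [Ky|Ky] := pselect (K y); first exact/ca/KU.
  apply: (@continuous_near_eq _ _ _ (cst 0)); last exact: cst_continuous.
  by apply: filterS (open_nbhs_nbhs (conj oK Ky)) => z; exact: a0.
have CF : C1_on setT (f \* phi).
  move=> y _; have [Ky|Ky] := pselect (K y).
    apply: (C1_onM oU Cf _ (KU y Ky)) => z _; exact: Cphi.
  apply: (@C1_on_near _ _ (~` K) _ (cst 0)); [|exact: C1_on_cst|by []].
  by move=> z /phi_near; apply: filterS => w /= ->; rewrite mulr0.
have dFE y : 'D_v (f \* phi) y = f y * 'D_v phi y + 'D_v f y * phi y.
  have [Ky|Ky] := pselect (K y).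
    rewrite deriveM; [|exact: diff_derivable (Cf y (KU y Ky)).1|].
      by rewrite [phi y *: _]mulrC.
    exact: diff_derivable (Cphi y I).1.
  rewrite dphi0// phi0// !mulr0 addr0 (@near_eq_derive _ _ _ _ (cst 0)) ?derive_cst//.
  by have := phi_near y Ky; apply: filterS => w /= ->; rewrite mulr0.
have ia : mu.-integrable setT (fun y => (f y * 'D_v phi y)%:E).
  apply: (continuous_supp_integrable mu_ball (M := M + 1)).
    apply: cU => y; last by move=> /dphi0 ->; rewrite mulr0.
    move=> Uy; apply: continuousM; last exact: (Cphi y I).2.
    by apply: differentiable_continuous; have [] := Cf y Uy.
  by apply: suppM => y /dphi0 ->; rewrite mulr0.
have ib : mu.-integrable setT (fun y => ('D_v f y * phi y)%:E).
  apply: (continuous_supp_integrable mu_ball (M := M + 1)).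
    apply: cU => y; last by move=> /phi0 ->; rewrite mulr0.
    move=> Uy; apply: continuousM; first exact: (Cf y Uy).2.
    by apply: differentiable_continuous; have [] := Cphi y I.
  by apply: suppM => y /phi0 ->; rewrite mulr0.
have : (\int[mu]_y ('D_v (f \* phi) y)%:E = 0)%E.
  apply: (integral_derive_eq0 muE mu_ball (M := M + 1)).
  - by move=> y; apply: differentiable_continuous; have [] := CF y I.
  - by move=> y; apply: diff_derivable; have [] := CF y I.
  - by move=> y; exact: (CF y I).2.
  - by apply: suppM => y /phi0 /= ->; rewrite mulr0.
have -> : (\int[mu]_y ('D_v (f \* phi) y)%:E =
    \int[mu]_y ((f y * 'D_v phi y)%:E + ('D_v f y * phi y)%:E))%E.
  by apply: eq_integral => y _; rewrite dFE EFinD.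
rewrite integralD//.
have /fineK <- := integrable_fin_num measurableT ia.
have /fineK <- := integrable_fin_num measurableT ib.
by rewrite -EFinD -EFinN => -[/eqP]; rewrite addr_eq0 => /eqP ->.
Qed.

End IntegrationByParts.

(** * Positive definite quadratic forms *)

Section QuadraticForms.
Variables (R : realType) (n : nat).
Implicit Types (G : 'M[R]_n) (u v : 'rV[R]_n).

Definition bform G u v : R := (u *m G *m v^T) 0 0.
Definition qform G v : R := bform G v v.
Definition posdef G : Prop := G^T = G /\ forall v, v != 0 -> 0 < qform G v.

Lemma bformDl G u1 u2 v : bform G (u1 + u2) v = bform G u1 v + bform G u2 v.
Proof. by rewrite /bform !mulmxDl mxE. Qed.

Lemma bformDr G u v1 v2 : bform G u (v1 + v2) = bform G u v1 + bform G u v2.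
Proof. by rewrite /bform raddfD/= mulmxDr mxE. Qed.

Lemma bformZl G a u v : bform G (a *: u) v = a * bform G u v.
Proof. by rewrite /bform -!scalemxAl mxE. Qed.

Lemma bformZr G a u v : bform G u (a *: v) = a * bform G u v.
Proof. by rewrite /bform linearZ/= -scalemxAr mxE. Qed.

Lemma qformZ G a v : qform G (a *: v) = a ^+ 2 * qform G v.
Proof. by rewrite /qform bformZl bformZr mulrA. Qed.

Lemma qformN G v : qform G (- v) = qform G v.
Proof. by rewrite -scaleN1r qformZ sqrrN expr1n mul1r. Qed.

Lemma qform0 G : qform G 0 = 0.
Proof. by rewrite -(scale0r 0) qformZ expr0n/= mul0r. Qed.

Lemma qform_scale G a v : qform (a *: G) v = a * qform G v.
Proof. by rewrite /qform /bform -scalemxAr -scalemxAl mxE. Qed.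

Lemma qform_ge0 G v : posdef G -> 0 <= qform G v.
Proof.
move=> [_ Gp]; have [->|/Gp/ltW//] := eqVneq v 0.
by rewrite qform0.
Qed.

Lemma bformC G u v : G^T = G -> bform G u v = bform G v u.
Proof.
move=> GT; rewrite /bform [in RHS](_ : v *m G *m u^T = (u *m G *m v^T)^T) ?mxE//.
by rewrite !trmx_mul trmxK GT mulmxA.
Qed.

Lemma bform_cauchy_schwarz G u v : posdef G ->
  `|bform G u v| <= Num.sqrt (qform G u) * Num.sqrt (qform G v).
Proof.
move=> [GT Gp]; have G0 w : 0 <= qform G w by apply: qform_ge0.
have [->|v0] := eqVneq v 0.
  by rewrite -(scale0r 0) bformZr mul0r normr0 mulr_ge0// sqrtr_ge0.
have qv := Gp v v0.
rewrite -sqrtrM// -sqrtr_sqr ler_sqrt ?mulr_ge0//.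
have := G0 (qform G v *: u - bform G u v *: v).
have -> : qform G (qform G v *: u - bform G u v *: v) =
    qform G v * (qform G u * qform G v - bform G u v ^+ 2).
  rewrite -[- (bform G u v *: v)]scaleNr /qform !(bformDl, bformDr).
  rewrite !(bformZl, bformZr) (bformC v u GT).
  ring.
by rewrite pmulr_rge0// subr_ge0.
Qed.

Lemma posdef_unit G : posdef G -> G \in unitmx.
Proof.
move=> [_ Gp]; rewrite -row_free_unit; apply: inj_row_free => v vG.
apply/eqP/negP => /negP /Gp; rewrite /qform /bform vG mul0mx mxE ltxx.
by [].
Qed.

(** The norm of a covector is attained on the vector dual to it. *)
Lemma covector_norm_le G (d : 'I_n -> R) (K : R) : posdef G -> 0 <= K ->
  (forall v, `|dotv d v| <= K * Num.sqrt (qform G v)) ->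
  ((\row_i d i) *m invmx G *m (\row_i d i)^T) 0 0 <= K ^+ 2.
Proof.
move=> Gp K0 dK; set w := \row_i d i.
have Gu := posdef_unit Gp; have [GT _] := Gp.
pose v := w *m invmx G.
have qv : qform G v = (w *m invmx G *m w^T) 0 0.
  by rewrite /qform /bform /v mulmxKV// trmx_mul trmx_inv GT mulmxA.
have dv : dotv d v = qform G v.
  by rewrite qv -/v mxE; apply: eq_bigr => i _; rewrite !mxE.
rewrite -qv; have := dK v; rewrite dv.
have q0 := qform_ge0 v Gp; rewrite ger0_norm// -{1 3}(sqr_sqrtr q0).
have := sqrtr_ge0 (qform G v); set s := Num.sqrt _.
rewrite le_eqVlt => /predU1P[<- _|s0]; first by rewrite expr0n/= sqr_ge0.
by rewrite expr2 ler_pM2r// => sK; rewrite -expr2 ler_sqr// nnegrE ltW.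
Qed.

Lemma qformE G v : qform G v = \sum_i \sum_j v 0 i * G i j * v 0 j.
Proof.
rewrite /qform /bform mxE exchange_big/=; apply: eq_bigr => j _.
by rewrite !mxE mulr_suml.
Qed.

Lemma qform_entries_le G v (e : R) : (forall i j, `|G i j| <= e) ->
  `|qform G v| <= n%:R ^+ 2 * e * `|v| ^+ 2.
Proof.
move=> Ge; rewrite qformE.
have bd i j : `|v 0 i * G i j * v 0 j| <= e * `|v| ^+ 2.
  rewrite !normrM mulrAC mulrC ler_pM ?mulr_ge0//.
  by rewrite expr2 ler_pM// mx_norm_entry.
rewrite (le_trans (ler_norm_sum _ _ _))//.
rewrite (@le_trans _ _ (\sum_(i < n) \sum_(j < n) e * `|v| ^+ 2))//.
  by apply: ler_sum => i _; rewrite (le_trans (ler_norm_sum _ _ _))// ler_sum.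
rewrite -mulrA; set c := e * _.
by rewrite !sumr_const !card_ord -mulrnA -[leLHS]mulr_natl natrM expr2.
Qed.

Lemma qform_continuous G : continuous (qform G).
Proof.
rewrite (_ : qform G = fun v => \sum_i \sum_j v 0 i * G i j * v 0 j); last first.
  by apply/funext => v; exact: qformE.
move=> v; apply: continuous_at_sum => i; apply: continuous_at_sum => j.
have c k : {for v, continuous (fun v : 'rV[R]_n => v 0 k)}.
  by apply: differentiable_continuous; exact: differentiable_coord.
apply: continuousM; last exact: c.
by apply: continuousM; [exact: c|exact: cst_continuous].
Qed.

(** The form has a positive minimum on the unit sphere, which is compact. *)
Lemma qform_lower G : posdef G -> exists2 c, 0 < c & forall v, c * `|v| ^+ 2 <= qform G v.
Proof.
move=> Gp; pose S := [set v : 'rV[R]_n | `|v| = 1].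
have cS : compact S.
  apply: bounded_closed_compact.
    by exists 1; split; [exact: num_real|move=> N /ltW N1 y /= ->].
  rewrite (_ : S = (fun y : 'rV[R]_n => `|y|) @^-1` [set 1]) //.
  by apply: closed_comp => [y _|]; [exact: norm_continuous|exact: closed_eq].
have [[v0 Sv0]|noS] := pselect (S !=set0); last first.
  exists 1 => // v; have [->|vn0] := eqVneq v 0.
    by rewrite normr0 qform0 expr0n mulr0.
  exfalso; apply: noS; exists (`|v|^-1 *: v).
  by rewrite /S/= normrZ normfV normr_id mulVf// normr_eq0.
have [||v Sv vmin] := @EVT_min_rV R n (qform G) S _ cS.
- by exists v0.
- by apply: continuous_subspaceT => y; exact: qform_continuous.
have vn0 : v != 0 by rewrite -normr_eq0; move: Sv; rewrite inE/= => ->; rewrite oner_eq0.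
exists (qform G v); first exact: Gp.2.
move=> w; have [->|wn0] := eqVneq w 0; first by rewrite normr0 qform0 expr0n mulr0.
have nw : 0 < `|w| by rewrite normr_gt0.
have /vmin : `|w|^-1 *: w \in S.
  by rewrite inE /S/= normrZ normfV normr_id mulVf// gt_eqF.
by rewrite qformZ exprVn mulrC ler_pdivlMr ?exprn_gt0.
Qed.

Lemma posdef_interpolate G (s : R) : posdef G -> 0 <= s <= 1 ->
  posdef (s *: G + (1 - s) *: 1%:M).
Proof.
move=> [GT Gp] /andP[s0 s1]; split => [|v v0].
  by rewrite linearD/= !linearZ/= GT trmx1.
have -> : qform (s *: G + (1 - s) *: 1%:M) v = s * qform G v + (1 - s) * qform 1%:M v.
  by rewrite -!qform_scale /qform /bform mulmxDr mulmxDl mxE.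
have q1 : 0 < qform 1%:M v.
  rewrite /qform /bform mulmx1 mxE; under eq_bigr do rewrite mxE -expr2.
  rewrite lt_def sumr_ge0 ?andbT; last by move=> i _; exact: sqr_ge0.
  apply: contra v0 => /eqP/psumr_eq0P v0; apply/eqP/rowP => i; rewrite mxE.
  by apply/eqP; rewrite -sqrf_eq0; apply/eqP/v0 => // j _; exact: sqr_ge0.
have := Gp v v0; have := mulr_ge0 s0 (ltW (Gp v v0)); nra.
Qed.

(** The determinant cannot vanish on the segment from the identity to G. *)
Lemma posdef_det_gt0 G : posdef G -> 0 < \det G.
Proof.
move=> Gp.
pose P : {poly R} := \det ('X *: map_mx polyC G + (1 - 'X) *: 1%:M).
have PE s : P.[s] = \det (s *: G + (1 - s) *: 1%:M).
  rewrite /P -horner_evalE -det_map_mx; congr (\det _); apply/matrixP => i j.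
  rewrite [LHS]mxE !mxE.
  by case: (i == j); rewrite /= /horner_eval !hornerE.
have P0 : P.[0] = 1 by rewrite PE scale0r add0r subr0 scale1r det1.
have P1 : P.[1] = \det G by rewrite PE subrr scale0r addr0 scale1r.
rewrite ltNge; apply/negP => dG.
have [||s s01 /eqP] := @poly_ivt R (- P) 0 1; rewrite ?ler01//.
  by rewrite !hornerN P0 P1 oppr_ge0 dG andbT lerNl oppr0 ler01.
rewrite hornerN PE => /eqP; rewrite oppr_eq0 => /eqP ds.
have := posdef_unit (posdef_interpolate Gp s01).
by rewrite unitmxE ds unitr0.
Qed.

End QuadraticForms.

(** * Charts and differentials *)

Section Charts.
Variables (R : realType) (M : ptopologicalType) (n : nat).
Variable X : smooth_structure R M n.
Local Notation chart := (chart R M n).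
Implicit Types (c : chart) (p : M) (y v : 'rV[R]_n) (u : M -> R).

Section OneChart.
Variables (c : chart) (Xc : atlas X c).

Lemma chart_coordK p : chart_dom c p -> chart_param c (chart_coord c p) = p.
Proof. by have [_ _ + _ _] := atlas_chart Xc; apply. Qed.

Lemma chart_img_coord p : chart_dom c p -> chart_img c (chart_coord c p).
Proof. by move=> cp; exists p. Qed.

Lemma chart_paramK y : chart_img c y -> chart_coord c (chart_param c y) = y.
Proof. by move=> [p cp <-]; rewrite chart_coordK. Qed.

Lemma chart_dom_param y : chart_img c y -> chart_dom c (chart_param c y).
Proof. by move=> [p cp <-]; rewrite chart_coordK. Qed.

Lemma open_chart_dom : open (chart_dom c).
Proof. by have [] := atlas_chart Xc. Qed.

Lemma open_chart_img : open (chart_img c).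
Proof. by have [] := atlas_chart Xc. Qed.

Lemma continuous_coord p : chart_dom c p -> {for p, continuous (chart_coord c)}.
Proof.
have [od _ _ cc _] := atlas_chart Xc.
by move: cc; rewrite continuous_open_subspace// => cc cp; apply: cc; rewrite inE.
Qed.

Lemma continuous_param y : chart_img c y -> {for y, continuous (chart_param c)}.
Proof.
have [_ oi _ _ cc] := atlas_chart Xc.
by move: cc; rewrite continuous_open_subspace// => cc cy; apply: cc; rewrite inE.
Qed.

Lemma open_param_image (W : set 'rV[R]_n) : open W -> W `<=` chart_img c ->
  open (chart_param c @` W).
Proof.
move=> oW Wc.
have -> : chart_param c @` W = chart_dom c `&` chart_coord c @^-1` W.
  apply/seteqP; split => [_ [y Wy <-]|p [cp Wp]].
    by split => /=; [exact/chart_dom_param/Wc|rewrite chart_paramK//; exact: Wc].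
  by exists (chart_coord c p) => //; exact: chart_coordK.
rewrite openE => p [cp Wp]; apply: filterI.
  by apply: open_nbhs_nbhs; split => //; exact: open_chart_dom.
by apply: (continuous_coord cp); apply: open_nbhs_nbhs.
Qed.

End OneChart.

Definition overlap c c' : set 'rV[R]_n :=
  chart_coord c @` (chart_dom c `&` chart_dom c').

Definition transition c c' y : 'rV[R]_n := chart_coord c' (chart_param c y).

Lemma open_overlap c c' : atlas X c -> atlas X c' -> open (overlap c c').
Proof.
move=> Xc Xc'; rewrite openE => _ [p [cp c'p] <-].
have near_img : nbhs (chart_coord c p) (chart_img c).
  apply: open_nbhs_nbhs; split; first exact: open_chart_img.
  exact: chart_img_coord.
have near_dom : \forall y \near chart_coord c p, chart_dom c' (chart_param c y).
  apply: (continuous_param Xc (chart_img_coord cp)).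
  rewrite (chart_coordK Xc cp).
  by apply: open_nbhs_nbhs; split => //; exact: open_chart_dom Xc'.
apply: filterS2 near_img near_dom => y iy dy.
exists (chart_param c y); last exact: chart_paramK Xc _ iy.
by split=> //; exact: chart_dom_param Xc _ iy.
Qed.

Lemma C1_transition c c' k : atlas X c -> atlas X c' ->
  C1_on (overlap c c') (fun y => transition c c' y 0 k).
Proof.
move=> Xc Xc'; apply: smooth_on_C1; first exact: open_overlap.
exact: (transition_smooth Xc Xc' k).
Qed.

(** The derivative of a transition map acts on row vectors through the
transposed Jacobian. *)
Lemma derive_transition c c' y v : atlas X c -> atlas X c' -> overlap c c' y ->
  (\row_k 'D_v (fun z => transition c c' z 0 k) y : 'rV[R]_n) =
  v *m (transition_jacobian c c' y)^T.
Proof.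
move=> Xc Xc' oy; apply/rowP => k; rewrite !mxE derive_dotv; last first.
  by have [] := C1_transition k Xc Xc' oy.
by apply: eq_bigr => i _; rewrite !mxE.
Qed.

Definition C1_fun u : Prop :=
  forall c, atlas X c -> C1_on (chart_img c) (u \o chart_param c).

Definition diff_form u : covector_field R M n :=
  fun c p => \row_i partial i (u \o chart_param c) (chart_coord c p).

Lemma C1_fun_continuous u : C1_fun u -> continuous u.
Proof.
move=> Cu p; pose c := chart_at X p.
have Xc : atlas X c by exact: chart_at_atlas.
have cp : chart_dom c p by exact: chart_at_dom.
apply: (@continuous_near_eq _ _ _ ((u \o chart_param c) \o chart_coord c)).
  apply: filterS (open_nbhs_nbhs (conj (open_chart_dom Xc) cp)) => q cq /=.
  by rewrite (chart_coordK Xc).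
apply: continuous_comp; first exact: continuous_coord.
by apply: differentiable_continuous; have [] := Cu c Xc _ (chart_img_coord cp).
Qed.

(** The chain rule makes the partial derivatives of u in all charts the
components of one covector field. *)
Lemma derive_change_chart u c c' p v : atlas X c -> atlas X c' -> C1_fun u ->
  chart_dom c p -> chart_dom c' p ->
  'D_v (u \o chart_param c) (chart_coord c p) =
  'D_(v *m (transition_jacobian c c' (chart_coord c p))^T)
    (u \o chart_param c') (chart_coord c' p).
Proof.
move=> Xc Xc' Cu cp c'p.
have op : overlap c c' (chart_coord c p) by exists p.
have tp : transition c c' (chart_coord c p) = chart_coord c' p.
  by rewrite /transition (chart_coordK Xc).
transitivity ('D_v ((u \o chart_param c') \o transition c c') (chart_coord c p)).
  apply: near_eq_derive.
  apply: filterS (open_nbhs_nbhs (conj (open_overlap Xc Xc') op)).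
  move=> _ [q [cq c'q] <-] /=.
  by rewrite /transition (chart_coordK Xc)// (chart_coordK Xc').
have [|_ ->] := @is_derive_map _ _ _ (transition c c') (u \o chart_param c')
    (chart_coord c p) v (fun k => (C1_transition k Xc Xc' op).1).
  by rewrite tp; have [] := Cu c' Xc' _ (chart_img_coord c'p).
by rewrite derive_transition// tp.
Qed.

Lemma diff_form_covector_field u : C1_fun u -> is_covector_field X (diff_form u).
Proof.
move=> Cu; split => [c i Xc|c c' p Xc Xc' cp c'p].
  apply: borel_continuous_measurable; first exact: open_chart_dom Xc.
  move=> p cp.
  apply: (@continuous_near_eq _ _ _
    ((fun y => partial i (u \o chart_param c) y) \o chart_coord c)).
    by near=> q; rewrite mxE.
  apply: continuous_comp; first exact: continuous_coord Xc _ cp.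
  exact: (Cu c Xc _ (chart_img_coord cp)).2.
apply/rowP => i; rewrite !mxE /partial (derive_change_chart _ Xc Xc')//.
rewrite derive_dotv; last exact: (Cu c' Xc' _ (chart_img_coord c'p)).1.
apply: eq_bigr => k _; rewrite mulrC; congr (_ * _); first by rewrite mxE.
rewrite mxE (bigD1 i)//= !mxE !eqxx/= mul1r big1 ?addr0// => j ji.
by rewrite !mxE (negbTE ji) andbF mul0r.
Unshelve. all: by end_near. Qed.

Lemma diff_form_weak_differential u :
  C1_fun u -> is_weak_differential X u (diff_form u).
Proof.
move=> Cu c i phi Xc [sphi [K [cK Kc phi0]]].
transitivity (- \int[@lebesgue_rV R n]_y
    (partial i (u \o chart_param c) y * phi y)%:E)%E.
  apply: (@integration_by_parts_rV _ _ (chart_img c) K (u \o chart_param c)) => //.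
  - exact: open_chart_img Xc.
  - exact: Cu.
  - by apply: smooth_on_C1 => //; exact: openT.
congr (- integral _ _ _)%E; apply/funext => y; congr (_%:E).
have [Ky|Ky] := pselect (K y); last by rewrite phi0// !mulr0.
by rewrite mxE (chart_paramK Xc)//; exact: Kc.
Qed.

Section Metric.
Variables (g : metric_tensor R M n) (hg : is_riemannian X g).

Lemma riemannian_posdef c y : atlas X c -> chart_img c y -> posdef (g c y).
Proof. by have [_ gs gp _] := hg; move=> Xc cy; split; [exact: gs|move=> v; exact: gp]. Qed.

Lemma riemannian_entry_continuous c y i j : atlas X c -> chart_img c y ->
  {for y, continuous (fun z => g c z i j)}.
Proof. by have [gs _ _ _] := hg; move=> Xc cy; have [+ _] := gs c i j Xc 0%N; apply. Qed.

Lemma qform_change_chart c c' p v : atlas X c -> atlas X c' ->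
  chart_dom c p -> chart_dom c' p ->
  qform (g c' (chart_coord c' p))
    (v *m (transition_jacobian c c' (chart_coord c p))^T) =
  qform (g c (chart_coord c p)) v.
Proof.
move=> Xc Xc' cp c'p; have [_ _ _ /(_ c c' p Xc Xc' cp c'p) /= ->] := hg.
by rewrite /qform /bform trmx_mul trmxK !mulmxA.
Qed.

(** Bounding the gradient of u by K amounts to bounding its derivative in every
direction v by K |v|, in whichever chart is convenient. *)
Lemma covector_sqnorm_le u p (K : R) : C1_fun u -> 0 <= K ->
  (forall c v, atlas X c -> chart_dom c p ->
     `|'D_v (u \o chart_param c) (chart_coord c p)| <=
       K * Num.sqrt (qform (g c (chart_coord c p)) v)) ->
  covector_sqnorm X g (diff_form u) p <= K ^+ 2.
Proof.
move=> Cu K0 duK; rewrite /covector_sqnorm; set c := chart_at X p.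
have Xc : atlas X c by exact: chart_at_atlas.
have cp : chart_dom c p by exact: chart_at_dom.
apply: covector_norm_le => //; first exact/riemannian_posdef/chart_img_coord.
move=> v; rewrite -derive_dotv; first exact: duK.
exact: (Cu c Xc _ (chart_img_coord cp)).1.
Qed.

End Metric.
End Charts.

(** * Distance, balls and frames *)

Section Frames.
Variables (R : realType) (M : ptopologicalType) (n : nat).
Variable X : smooth_structure R M n.
Variables (g : metric_tensor R M n) (hg : is_riemannian X g).
Local Notation chart := (chart R M n).
Implicit Types (c : chart) (p q x : M) (y v w : 'rV[R]_n).

Lemma path_of_length_cat p q s (l l' : R) : path_of_length X g p q l ->
  path_of_length X g q s l' -> path_of_length X g p s (l + l').
Proof.
move=> pq qs; elim: pq qs => [{}p|c gam {}q {}l Xc gC gc _ IH] qs.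
  by rewrite add0r.
by rewrite -addrA; apply: path_cons => //; exact: IH.
Qed.

Lemma segment_path c (G : 'M[R]_n) y0 y1 : atlas X c ->
  (forall s, 0 <= s <= 1 -> chart_img c (s *: (y1 - y0) + y0)) ->
  (forall s v, 0 <= s <= 1 ->
     qform (g c (s *: (y1 - y0) + y0)) v <= qform G v) ->
  exists2 l, path_of_length X g (chart_param c y0) (chart_param c y1) l &
    l <= Num.sqrt (qform G (y1 - y0)).
Proof.
move=> Xc simg sG; pose gam (s : R) : 'rV[R]_n := s *: (y1 - y0) + y0.
have dgam (s : R) : is_derive s (1 : R) gam (y1 - y0) by exact: is_derive_affine.
have d1gam : derive1 gam = cst (y1 - y0).
  by apply/funext => s; rewrite derive1E; have [_ ->] := dgam s.
have gam0 : gam 0 = y0 by rewrite /gam scale0r add0r.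
have gam1 : gam 1 = y1 by rewrite /gam scale1r subrK.
exists (curve_length (g c) gam + 0).
  rewrite -[in X in path_of_length _ _ X]gam0 -[in X in path_of_length _ _ _ X]gam1.
  apply: path_cons => //; last exact: path_nil.
  split=> [s|]; first by have [] := dgam s.
  by rewrite d1gam => s; exact: cst_continuous.
rewrite addr0 /curve_length /Rintegral.
set C := Num.sqrt (qform G _); have C0 : 0 <= C by exact: sqrtr_ge0.
rewrite -[leRHS]/(fine C%:E).
have I0 : (0 <= \int[@lebesgue_measure R]_(s in `[0%R, 1%R])
    (Num.sqrt ((gam^`()%classic s *m g c (gam s) *m (gam^`()%classic s)^T) 0 0))%:E)%E.
  by apply: integral_ge0 => s _; rewrite lee_fin sqrtr_ge0.
have I1 : (\int[@lebesgue_measure R]_(s in `[0%R, 1%R])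
    (Num.sqrt ((gam^`()%classic s *m g c (gam s) *m (gam^`()%classic s)^T) 0 0))%:E
    <= C%:E)%E.
  apply: (@le_trans _ _ (\int[@lebesgue_measure R]_(s in `[0%R, 1%R]) C%:E)%E).
    apply: le_integral_pointwise => s /=; rewrite in_itv/= => s01.
    by rewrite lee_fin d1gam ler_wsqrtr//; exact: sG.
  by rewrite integral_cst//= lebesgue_measure_itv/= lte_fin ltr01 oppr0 adde0 mule1.
apply: fine_le => //.
by rewrite ge0_fin_numE// (le_lt_trans I1)// ltry.
Qed.

(** Straight segments in charts are the source of all upper bounds on distances;
apart from zero, the lower bounds come from the triangle inequality alone. *)
Lemma riem_dist_segment x c (G : 'M[R]_n) y0 y1 : atlas X c ->
  (forall s, 0 <= s <= 1 -> chart_img c (s *: (y1 - y0) + y0)) ->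
  (forall s v, 0 <= s <= 1 ->
     qform (g c (s *: (y1 - y0) + y0)) v <= qform G v) ->
  (riem_dist X g x (chart_param c y1) <=
   riem_dist X g x (chart_param c y0) + (Num.sqrt (qform G (y1 - y0)))%:E)%E.
Proof.
move=> Xc simg sG; have [l y01 lG] := segment_path Xc simg sG.
rewrite -leeBlDr//; apply: le_ereal_inf_tmp => _ [k xk <-].
rewrite leeBlDr//; apply: (@le_trans _ _ (k + l)%:E).
  by apply: ereal_inf_lbound; exists (k + l) => //; exact: path_of_length_cat y01.
by rewrite EFinD leeD2l.
Qed.

(** In a frame the coordinates are almost isometric: up to the factor sigma,
the metric is the constant G on a G-ball of radius S. *)
Definition frame (sigma : R) c (G : 'M[R]_n) q (S : R) : Prop :=
  [/\ atlas X c, chart_dom c q, posdef G &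
    forall y, qform G (y - chart_coord c q) <= S ^+ 2 -> chart_img c y /\
      forall v, qform (g c y) v <= qform G v /\
                qform G v <= sigma * qform (g c y) v].

Lemma qform_near c y0 (e : R) : atlas X c -> chart_img c y0 -> 0 < e ->
  \forall y \near y0, forall v,
    `|qform (g c y) v - qform (g c y0) v| <= e * qform (g c y0) v.
Proof.
move=> Xc cy0 e0.
have [k k0 kG] := qform_lower (riemannian_posdef hg Xc cy0).
pose d := e * k / (n.+1%:R ^+ 2).
have d0 : 0 < d by rewrite divr_gt0 ?mulr_gt0// exprn_gt0// ltr0Sn.
have : \forall y \near y0, forall i j, `|(g c y - g c y0) i j| <= d.
  apply: (@filter_forall _ _ (fun i y => forall j, `|(g c y - g c y0) i j| <= d)
    (nbhs y0) (nbhs_filter y0)) => i.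
  apply: (@filter_forall _ _ (fun j y => `|(g c y - g c y0) i j| <= d)
    (nbhs y0) (nbhs_filter y0)) => j.
  have /cvgrPdist_le/(_ _ d0) :=
    @riemannian_entry_continuous _ _ _ _ _ hg c y0 i j Xc cy0.
  by apply: filterS => y; rewrite !mxE distrC.
apply: filterS => y yd v.
have -> : qform (g c y) v - qform (g c y0) v = qform (g c y - g c y0) v.
  rewrite /qform /bform mulmxBr mulmxBl.
  by move: (_ *m _) (v *m g c y0 *m _) => P Q; rewrite !mxE.
rewrite (le_trans (qform_entries_le _ yd))//.
rewrite (@le_trans _ _ (e * (k * `|v| ^+ 2)))//; last by rewrite ler_wpM2l// ltW.
rewrite [leRHS]mulrA ler_wpM2r ?sqr_ge0// /d mulrCA ler_piMr ?mulr_ge0 ?(ltW e0) ?(ltW k0)//.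
rewrite ler_pdivrMr ?exprn_gt0 ?ltr0Sn// mul1r -!natrX ler_nat leq_sqr.
exact: leqnSn.
Qed.

(** Near p the metric is within a factor 1 - e and 1 + e of its value at p, so
that G = (1 + e) g(p) works for sigma = (1 + e) / (1 - e); compactness makes
the radius uniform. *)
Lemma frames_exist (sigma : R) : compact [set: M] -> 1 < sigma ->
  \forall S \near (0 : R)^'+, forall q, exists c G, frame sigma c G q S.
Proof.
move=> /compact_near_coveringP Mc sigma1.
suff : \forall S \near (0 : R)^'+,
    [set: M] `<=` [set q | exists c G, frame sigma c G q S].
  by apply: filterS => S h q; exact: h.
apply: Mc => p _; pose c := chart_at X p.
have Xc : atlas X c by exact: chart_at_atlas.
have cp : chart_dom c p by exact: chart_at_dom.
have cy0 := chart_img_coord cp.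
set y0 := chart_coord c p in cy0.
have G0p := riemannian_posdef hg Xc cy0.
pose e := (sigma - 1) / (sigma + 1).
have e0 : 0 < e by rewrite divr_gt0//; lra.
pose G := (1 + e) *: g c y0.
have Gp : posdef G.
  split=> [|v v0]; first by rewrite linearZ/= G0p.1.
  by rewrite qform_scale mulr_gt0//; [lra|exact: G0p.2].
have [k k0 kG] := qform_lower Gp.
have [r r0 rP] : exists2 r, 0 < r & forall y, `|y - y0| < r -> chart_img c y /\
    forall v, qform (g c y) v <= qform G v /\ qform G v <= sigma * qform (g c y) v.
  have near_img : nbhs y0 (chart_img c).
    by apply: open_nbhs_nbhs; split => //; exact: open_chart_img Xc.
  have : \forall y \near y0, chart_img c y /\ forall v,
      `|qform (g c y) v - qform (g c y0) v| <= e * qform (g c y0) v.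
    by apply: filterI => //; exact: qform_near.
  move=> /nbhs_ballP[r /= r0 rP].
  exists r => // y yr; have [|iy yv] := rP y.
    by rewrite -ball_normE /ball_/= distrC.
  split => // v; have := yv v; rewrite qform_scale ler_norml.
  have := qform_ge0 v G0p; set a := qform _ _; set b := qform _ _ => a0 /andP[ba ab].
  split; first by lra.
  have -> : 1 + e = sigma * (1 - e) by rewrite /e; field; lra.
  by rewrite -mulrA ler_wpM2l//; lra.
have nq : \forall q \near p, chart_dom c q /\ `|chart_coord c q - y0| < r / 2.
  have r20 : 0 < r / 2 by rewrite divr_gt0.
  apply: filterI; first by apply: open_nbhs_nbhs; split => //; exact: open_chart_dom Xc.
  have /cvgrPdist_lt/(_ _ r20) := continuous_coord Xc cp.
  by apply: filterS => q; rewrite distrC.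
have nS : \forall S \near (0 : R)^'+, 0 < S /\ S < r / 2 * Num.sqrt k.
  apply: filterI; first exact: nbhs_right_gt.
  by apply: nbhs_right_lt; rewrite mulr_gt0 ?divr_gt0// sqrtr_gt0.
near=> q S; exists c, G.
have [cq qr] : chart_dom c q /\ `|chart_coord c q - y0| < r / 2 by near: q.
have [S0 Sr] : 0 < S /\ S < r / 2 * Num.sqrt k by near: S.
split => // y yS; apply: rP.
suff : `|y - chart_coord c q| < r / 2.
  have := ler_normD (y - chart_coord c q) (chart_coord c q - y0).
  rewrite subrKA; lra.
have := le_trans (kG _) yS; set a := `|_|; have a0 : 0 <= a by exact: normr_ge0.
rewrite ltNge => aS; apply/negP => ra.
have : k * (r / 2) ^+ 2 <= k * a ^+ 2.
  by rewrite ler_pM2l// ler_sqr// nnegrE divr_ge0// ltW.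
have : S ^+ 2 < (r / 2 * Num.sqrt k) ^+ 2.
  by rewrite ltr_pXn2r// nnegrE ltW// mulr_gt0 ?divr_gt0// sqrtr_gt0.
rewrite /= in aS; rewrite [(_ * Num.sqrt k) ^+ 2]exprMn sqr_sqrtr ?(ltW k0)//; lra.
Unshelve. all: by end_near. Qed.

Lemma path_length_ge0 p q l : path_of_length X g p q l -> 0 <= l.
Proof.
elim=> // c gam {}q {}l _ _ _ _ l0; rewrite addr_ge0//.
by apply: fine_ge0; apply: integral_ge0 => s _; rewrite lee_fin sqrtr_ge0.
Qed.

Lemma riem_dist_ge0 x p : (0 <= riem_dist X g x p)%E.
Proof.
apply: le_ereal_inf_tmp => _ [l /path_length_ge0 l0 <-].
by rewrite lee_fin.
Qed.

Lemma riem_dist_refl x : riem_dist X g x x = 0%E.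
Proof.
apply/eqP; rewrite eq_le riem_dist_ge0 andbT.
by apply: ereal_inf_lbound; exists 0 => //; exact: path_nil.
Qed.

Section OneFrame.
Variables (sigma : R) (c : chart) (G : 'M[R]_n) (q : M) (S : R).
Hypothesis fr : frame sigma c G q S.

Lemma frame_dist x p : chart_dom c p ->
  qform G (chart_coord c p - chart_coord c q) <= S ^+ 2 ->
  (riem_dist X g x p <= riem_dist X g x q +
     (Num.sqrt (qform G (chart_coord c p - chart_coord c q)))%:E)%E /\
  (riem_dist X g x q <= riem_dist X g x p +
     (Num.sqrt (qform G (chart_coord c p - chart_coord c q)))%:E)%E.
Proof.
move=> cp pS; have [Xc cq Gp yP] := fr.
set y0 := chart_coord c q; set y1 := chart_coord c p.
have q0 := qform_ge0 (y1 - y0) Gp.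
have inS s : 0 <= s <= 1 -> s ^+ 2 * qform G (y1 - y0) <= S ^+ 2.
  move=> /andP[s0 s1]; apply: le_trans pS; rewrite ler_piMl//.
  by rewrite expr_le1.
have fwd s : 0 <= s <= 1 -> qform G (s *: (y1 - y0) + y0 - y0) <= S ^+ 2.
  by move=> s01; rewrite addrK qformZ; exact: inS.
have bwd s : 0 <= s <= 1 -> qform G (s *: (y0 - y1) + y1 - y0) <= S ^+ 2.
  move=> s01; rewrite -addrA -[y0 - y1]opprB scalerN -scaleNr.
  rewrite -[X in _ + X]scale1r -scalerDl qformZ; apply: inS; lra.
split.
- rewrite -[in leLHS](chart_coordK Xc cp) -[in leRHS](chart_coordK Xc cq).
  apply: riem_dist_segment => // [s s01|s v s01]; have [iy yv] := yP _ (fwd s s01) => //.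
  by have [] := yv v.
- rewrite -[in leLHS](chart_coordK Xc cq) -[in leRHS](chart_coordK Xc cp).
  rewrite -qformN opprB.
  apply: riem_dist_segment => // [s s01|s v s01]; have [iy yv] := yP _ (bwd s s01) => //.
  by have [] := yv v.
Qed.

Lemma frame_nbhs (e : R) : 0 < e -> \forall p \near q,
  chart_dom c p /\ qform G (chart_coord c p - chart_coord c q) < e.
Proof.
move=> e0; have [Xc cq Gp yP] := fr; apply: filterI.
  by apply: open_nbhs_nbhs; split => //; exact: open_chart_dom Xc.
have cont : {for q, continuous
    (fun p => qform G (chart_coord c p - chart_coord c q))}.
  apply: (@continuous_comp _ _ _ (fun p => chart_coord c p - chart_coord c q)
    (qform G)); last exact: qform_continuous.
  apply: (@continuous_comp _ _ _ (chart_coord c) (fun y => y - chart_coord c q)).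
    exact: continuous_coord Xc _ cq.
  exact: continuous_addr.
by apply: (cvgr_lt _ cont); rewrite subrr qform0.
Qed.

End OneFrame.

Hypothesis cM : compact [set: M].

Lemma frames_exist_lt (sigma e : R) : 1 < sigma -> 0 < e ->
  exists S : R, [/\ 0 < S, S < e & forall q, exists c G, frame sigma c G q S].
Proof.
move=> sigma1 e0.
have : \forall S \near (0 : R)^'+,
    [/\ 0 < S, S < e & forall q, exists c G, frame sigma c G q S].
  near=> S; split; near: S;
    [exact: nbhs_right_gt|exact: nbhs_right_lt|exact: frames_exist].
by move=> /filter_ex[S ?]; exists S.
Unshelve. all: by end_near. Qed.

Lemma open_geodesic_ball x (r : R) : open (geodesic_ball X g x r).
Proof.
rewrite openE => p xp; rewrite /interior.
have sigma1 : 1 < 2 :> R by lra.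
have [S [S0 _ Sfr]] := frames_exist_lt sigma1 ltr01.
have [c [G fr]] := Sfr p; have [Xc cp Gp _] := fr.
have dfin : riem_dist X g x p \is a fin_num.
  by rewrite ge0_fin_numE ?riem_dist_ge0// (lt_le_trans xp)// leey.
pose e := r - fine (riem_dist X g x p).
have e0 : 0 < e by rewrite subr_gt0 -lte_fin fineK.
have m0 : 0 < Num.min (S ^+ 2) (e ^+ 2) by rewrite lt_min !exprn_gt0.
apply: filterS (frame_nbhs fr m0) => p' [cp' p'm]; rewrite /geodesic_ball/=.
move: p'm; rewrite lt_min => /andP[p'S p'e].
have [+ _] := frame_dist fr x cp' (ltW p'S); move=> /le_lt_trans; apply.
rewrite -(fineK dfin) -EFinD lte_fin -ltrBrDl -/e.
by rewrite -(ger0_norm (ltW e0)) -sqrtr_sqr ltr_sqrt// exprn_gt0.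
Qed.

Lemma measurable_geodesic_ball x (r : R) :
  measurable (geodesic_ball X g x r : set (borel M)).
Proof. by apply: sub_sigma_algebra; exact: open_geodesic_ball. Qed.

Lemma subset_geodesic_ball x (r s : R) : r <= s ->
  geodesic_ball X g x r `<=` geodesic_ball X g x s.
Proof. by move=> rs p; rewrite /geodesic_ball/= => /lt_le_trans; apply; rewrite lee_fin. Qed.

Lemma det_continuous c y : atlas X c -> chart_img c y ->
  {for y, continuous (fun z => \det (g c z))}.
Proof.
move=> Xc cy; rewrite /determinant; apply: continuous_at_sum => s.
apply: continuousM; first exact: cst_continuous.
apply: continuous_at_prod => i.
exact: (riemannian_entry_continuous hg Xc cy).
Qed.

(** The geodesic ball of radius r contains a coordinate ball of radius a r, on
which the volume density is bounded below. *)
Lemma small_ball_volume (vol : {measure set (borel M) -> \bar R}) x :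
  is_volume X g vol -> exists v0 r0 : R, [/\ 0 < v0, 0 < r0 &
    forall r, 0 < r <= r0 -> ((v0 * r ^+ n)%:E <= vol (geodesic_ball X g x r))%E].
Proof.
move=> volP.
have sigma1 : 1 < 2 :> R by lra.
have [S [S0 _ Sfr]] := frames_exist_lt sigma1 ltr01.
have [c [G fr]] := Sfr x; have [Xc cx Gp yP] := fr.
set y0 := chart_coord c x in yP.
have iy0 : chart_img c y0 by exact: chart_img_coord.
pose C : R := n%:R ^+ 2 * `|G| + 1.
have C0 : 0 < C by rewrite ltr_wpDl// mulr_ge0// exprn_ge0.
have GC w : qform G w <= C * `|w| ^+ 2.
  rewrite (le_trans (ler_norm _))// (le_trans (qform_entries_le _ (mx_norm_entry G)))//.
  by rewrite ler_wpM2r ?sqr_ge0// lerDl.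
pose a := Num.sqrt C^-1.
have a0 : 0 < a by rewrite sqrtr_gt0 invr_gt0.
have aG w r : 0 <= r -> `|w| < a * r -> qform G w < r ^+ 2.
  move=> r0 wr; rewrite (le_lt_trans (GC w))//.
  rewrite -ltr_pdivlMl// -[C^-1]sqr_sqrtr ?invr_ge0 ?(ltW C0)// -/a -exprMn.
  by rewrite ltr_pXn2r// nnegrE// mulr_ge0// ltW.
have dy0 := posdef_det_gt0 (riemannian_posdef hg Xc iy0).
pose d := Num.sqrt (\det (g c y0) / 2).
have d0 : 0 < d by rewrite sqrtr_gt0 divr_gt0.
have [r1 r10 r1d] : exists2 r1, 0 < r1 & forall y, `|y - y0| < r1 ->
    d <= vol_density (g c) y.
  have : \forall y \near y0, \det (g c y0) / 2 < \det (g c y).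
    by apply: (cvgr_gt _ (det_continuous Xc iy0)); lra.
  move=> /nbhs_ballP[r1 /= r10 r1d]; exists r1 => // y yr.
  apply: ler_wsqrtr; apply: ltW; apply: r1d.
  by rewrite -ball_normE /ball_/= distrC.
exists (d * (a *+ 2) ^+ n), (Num.min S (r1 / a)); split.
- by rewrite mulr_gt0// exprn_gt0// pmulrn_rgt0.
- by rewrite lt_min S0 divr_gt0.
move=> r /andP[r0]; rewrite le_min => /andP[rS rr1].
have ar0 : 0 < a * r by rewrite mulr_gt0.
pose B : set 'rV[R]_n := ball y0 (a * r).
have BE y : B y -> `|y - y0| < a * r by rewrite /B -ball_normE /ball_/= distrC.
have qB y : B y -> qform G (y - y0) < r ^+ 2 by move=> /BE; apply: aG; exact: ltW.
have BS y : B y -> qform G (y - y0) <= S ^+ 2.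
  move=> /qB/ltW/le_trans; apply.
  by rewrite ler_sqr ?nnegrE// ltW.
have Bimg : B `<=` chart_img c by move=> y /BS /yP[].
have oB : open B by exact: ball_open.
have mE : measurable (chart_param c @` B : set (borel M)).
  by apply: sub_sigma_algebra; exact: (open_param_image Xc oB Bimg).
have Edom : chart_param c @` B `<=` chart_dom c.
  by move=> _ [y By <-]; exact: (chart_dom_param Xc (Bimg y By)).
have EB : chart_coord c @` (chart_param c @` B) = B.
  apply/seteqP; split => [_ [_ [y By <-] <-]|y By].
    by rewrite (chart_paramK Xc (Bimg y By)).
  exists (chart_param c y); first by exists y.
  exact: (chart_paramK Xc (Bimg y By)).
apply: (@le_trans _ _ (vol (chart_param c @` B))); last first.
  apply: le_measure; rewrite ?inE//; first exact: measurable_geodesic_ball.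
  move=> _ [y By <-]; rewrite /geodesic_ball/=.
  have cy := chart_dom_param Xc (Bimg y By).
  have yK := chart_paramK Xc (Bimg y By).
  have [|+ _] := frame_dist fr x cy; first by rewrite yK; exact: BS.
  move=> /le_lt_trans; apply; rewrite riem_dist_refl add0e lte_fin yK.
  by rewrite -(ger0_norm (ltW r0)) -sqrtr_sqr ltr_sqrt ?exprn_gt0//; exact: qB.
rewrite (volP c _ Xc mE Edom) EB.
have [mu [muE mu_ball]] := lebesgue_rV_measure R n.
rewrite (eq_setfun_integral _ _ muE).
have mB : measurable (B : set (borel 'rV[R]_n)) by exact: sub_sigma_algebra.
apply: (@le_trans _ _ (\int[mu]_(y in (B : set (borel 'rV[R]_n))) d%:E)%E).
  have muB : mu B = (((a * r) *+ 2) ^+ n)%:E by exact: mu_ball.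
  have -> : (\int[mu]_(y in (B : set (borel 'rV[R]_n))) d%:E =
      d%:E * (((a * r) *+ 2) ^+ n)%:E)%E.
    by rewrite integral_cst//; congr (_ * _)%E.
  by rewrite -EFinM lee_fin -mulrA -exprMn mulrnAl.
apply: le_integral_pointwise => y /BE yr; rewrite lee_fin; apply: r1d.
by rewrite (lt_le_trans yr)// mulrC -ler_pdivlMr.
Qed.

End Frames.

(** * Bump functions in frames *)

Section Bump.
Variable R : realType.

Lemma continuous_scaled (T : topologicalType) (c : R) (f : T -> R) :
  continuous f -> continuous (fun y => c * f y).
Proof. by move=> cf y; apply: cvgM; [exact: cvg_cst|exact: cf]. Qed.

Definition pospart (t : R) : R := Num.max 0 t.

Lemma pospart_ge0 t : 0 <= pospart t.
Proof. by rewrite /pospart le_max lexx. Qed.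

Lemma pospart_pos t : 0 <= t -> pospart t = t.
Proof. by move=> t0; rewrite /pospart max_r. Qed.

Lemma pospart_neg t : t <= 0 -> pospart t = 0.
Proof. by move=> t0; rewrite /pospart max_l. Qed.

Lemma pospart_le_norm t : pospart t <= `|t|.
Proof. by rewrite /pospart ge_max normr_ge0 ler_norm. Qed.

Lemma continuous_pospart : continuous pospart.
Proof.
have -> : pospart = fun t => (t + `|t|) / 2.
  by apply/funext => t; rewrite /pospart maxr_absE add0r sub0r normrN.
move=> t; apply: cvgM; last exact: cvg_cst.
by apply: cvgD; [exact: cvg_id|exact: norm_continuous].
Qed.

(** From the exponent two on, powers of the positive part are C^1, also at zero. *)
Lemma is_derive_pospart_exp m (t : R) :
  is_derive t (1 : R) (fun s => pospart s ^+ m.+2) (m.+2%:R * pospart t ^+ m.+1).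
Proof.
have [t0|t0|->] := ltgtP t 0.
- apply: (@near_eq_is_derive _ _ _ (cst 0)).
    near=> s; rewrite pospart_neg ?expr0n//.
    by apply: ltW; near: s; exact: lt_nbhsl.
  by rewrite pospart_neg ?(ltW t0)// expr0n mulr0; exact: is_derive_cst.
- apply: (@near_eq_is_derive _ _ _ (fun s : R => s ^+ m.+2)).
    near=> s; rewrite pospart_pos//.
    by apply: ltW; near: s; exact: lt_nbhsr.
  rewrite pospart_pos ?(ltW t0)//.
  by split; [exact: exprn_derivable|rewrite exp_derive [_ *: _]mulr1].
- rewrite pospart_neg// expr0n mulr0.
  have c0 : (fun h : R => h^-1 *: (((fun s => pospart s ^+ m.+2) \o shift 0) (h *: (1 : R))
    - pospart 0 ^+ m.+2)) @ (0 : R)^' --> (0 : R).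
    apply/cvgrPdist_lt => e e0; near=> h.
    have h0 : h != 0 by near: h; exact: nbhs_dnbhs_neq.
    have [h1 he] : `|h| < 1 /\ `|h| < e.
      split; near: h; apply: dnbhs0_lt => //.
    rewrite /= [_%:A]mulr1 addr0 (pospart_neg (lexx 0)) expr0n subr0 sub0r normrN.
    rewrite normrZ normfV ltr_pdivrMl ?normr_gt0// normrX (ger0_norm (pospart_ge0 h)).
    rewrite exprS (@le_lt_trans _ _ (`|h| * `|h|))// ?ltr_pM2l ?normr_gt0//.
    rewrite ler_pM ?exprn_ge0 ?pospart_ge0 ?pospart_le_norm//.
    rewrite (@le_trans _ _ (`|h| ^+ m.+1))// ?lerXn2r ?nnegrE ?pospart_ge0 ?pospart_le_norm//.
    by rewrite exprS ler_piMr// exprn_ile1// ltW.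
  by split; [apply/cvg_ex; exists 0|exact: cvg_lim].
Unshelve. all: by end_near. Qed.

Section QuadraticBump.
Variables (n : nat) (G : 'M[R]_n) (Gp : posdef G) (y0 : 'rV[R]_n).
Implicit Types (x v y : 'rV[R]_n).

Lemma is_derive_qform x v :
  is_derive x v (fun y => qform G (y - y0)) (2 * bform G (x - y0) v).
Proof.
have c : (fun h : R => h^-1 *: (((fun y => qform G (y - y0)) \o shift x) (h *: v)
    - qform G (x - y0))) @ (0 : R)^' --> (2 * bform G (x - y0) v : R).
  have cl : (fun h : R => 2 * bform G (x - y0) v + h * qform G v) @ (0 : R)^' -->
      (2 * bform G (x - y0) v : R).
    rewrite -[X in _ --> X]addr0; apply: cvgD; first exact: cvg_cst.
    rewrite -[X in _ --> X](mul0r (qform G v)); apply: cvgM; last exact: cvg_cst.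
    by apply: cvg_within; exact: cvg_id.
  apply: cvg_trans cl; apply: near_eq_cvg; near=> h.
  have h0 : h != 0 by near: h; exact: nbhs_dnbhs_neq.
  rewrite /= -addrA; move: (x - y0) => w.
  rewrite /qform !(bformDl, bformDr) !(bformZl, bformZr) (bformC v w Gp.1) -[LHS](mulKf h0); congr (_ * _); ring.
by split; [apply/cvg_ex; exists (2 * bform G (x - y0) v)|exact: cvg_lim].
Unshelve. all: by end_near. Qed.

Lemma C1_on_qform : C1_on setT (fun y => qform G (y - y0)).
Proof.
have dE v : (fun y => 'D_v (fun y => qform G (y - y0)) y) =
    (fun y => 2 * dotv (fun i => bform G (delta_mx 0 i) v) (y - y0)).
  apply/funext => y; have [_ ->] := is_derive_qform y v; congr (_ * _).
  rewrite [y - y0 in LHS]row_sum_delta /dotv /bform.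
  rewrite !mulmx_suml summxE; apply: eq_bigr => i _.
  by rewrite -!scalemxAl mxE.
have cd v : continuous (fun y => 'D_v (fun y => qform G (y - y0)) y).
  rewrite dE; apply: continuous_scaled => y.
  apply: (@continuous_comp _ _ _ (fun y => y - y0) (dotv _)).
    exact: continuous_addr.
  exact: continuous_dotv.
move=> x _; split; last by move=> v; exact: cd.
apply: (@differentiable_C1 _ _ setT) => [|i y _|i]; first exact: filterT.
  by case: (is_derive_qform y (delta_mx 0 i)).
exact: cd.
Qed.

Lemma C1_on_pospart_exp m k (U : set 'rV[R]_k) (f : 'rV[R]_k -> R) : open U ->
  C1_on U f -> C1_on U (fun z => pospart (f z) ^+ m.+2).
Proof.
move=> oU Cf; apply: (C1_on_comp (p := fun s => pospart s ^+ m.+2)) => // y Uy.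
split; first by case: (is_derive_pospart_exp m (f y)).
have -> : derive1 (fun s : R => pospart s ^+ m.+2) =
    (fun s => m.+2%:R * pospart s ^+ m.+1).
  by apply/funext => s; rewrite derive1E; case: (is_derive_pospart_exp m s).
apply: continuous_scaled => s.
apply: (continuous_comp (f := pospart) (g := fun s : R => s ^+ m.+1)).
  exact: continuous_pospart.
exact: exprn_continuous.
Qed.

Variables (S : R) (m : nat).

Definition quadratic_bump y : R := pospart (1 - qform G (y - y0) / S ^+ 2) ^+ m.+2.

Let C1_arg : C1_on setT (fun y => 1 - qform G (y - y0) / S ^+ 2).
Proof.
apply: (@C1_onD _ _ _ (cst 1)); [exact: openT|exact: C1_on_cst|].
apply: (@C1_on_near _ _ _ _ ((cst (- (S ^- 2))) \* (fun y => qform G (y - y0)))).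
  by move=> x _; near=> y; rewrite /= mulNr mulrC.
by apply: C1_onM; [exact: openT|exact: C1_on_cst|exact: C1_on_qform].
Unshelve. all: by end_near. Qed.

Lemma C1_quadratic_bump : C1_on setT quadratic_bump.
Proof. by apply: C1_on_pospart_exp C1_arg; exact: openT. Qed.

Lemma derive_quadratic_bump y v :
  'D_v quadratic_bump y =
  - (m.+2%:R * pospart (1 - qform G (y - y0) / S ^+ 2) ^+ m.+1 *
     (2 * bform G (y - y0) v / S ^+ 2)).
Proof.
have [d _] := C1_arg (I : setT y).
have [dp dE] := is_derive_pospart_exp m (1 - qform G (y - y0) / S ^+ 2).
have [_ ->] := is_derive_comp v d dp.
rewrite derive1E dE -[RHS]mulrN; congr (_ * _).
have [dq qE] := is_derive_qform y v.
rewrite deriveB; [|exact: derivable_cst|exact: derivableM dq (derivable_cst _ _ _)].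
rewrite derive_cst sub0r; congr (- _).
by rewrite deriveMr// qE mulrC.
Qed.

End QuadraticBump.
End Bump.

Section FrameBump.
Variables (R : realType) (M : ptopologicalType) (n : nat).
Variable X : smooth_structure R M n.
Variables (g : metric_tensor R M n) (hg : is_riemannian X g).
Variables (sigma : R) (c0 : chart R M n) (G : 'M[R]_n) (q : M) (S : R).
Hypotheses (fr : frame X g sigma c0 G q S) (S0 : 0 < S).

(** Squared distance to q in the frame, in units of the radius; any value at
least one would do off the chart, where the bump functions vanish. *)
Definition frame_sqdist p : R :=
  if `[< chart_dom c0 p >] then
    qform G (chart_coord c0 p - chart_coord c0 q) / S ^+ 2
  else 1.

Definition frame_bump m p : R := pospart (1 - frame_sqdist p) ^+ m.+2.

Let y0 := chart_coord c0 q.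
Let Xc0 : atlas X c0. Proof. by case: fr. Qed.
Let Gp : posdef G. Proof. by case: fr. Qed.

Lemma frame_sqdistE p : chart_dom c0 p ->
  frame_sqdist p = qform G (chart_coord c0 p - y0) / S ^+ 2.
Proof. by move=> cp; rewrite /frame_sqdist asboolT. Qed.

Lemma frame_sqdist_ge0 p : 0 <= frame_sqdist p.
Proof.
rewrite /frame_sqdist; case: ifP => // _.
by rewrite divr_ge0 ?sqr_ge0// qform_ge0.
Qed.

Lemma sqrt_frame_sqdist p : chart_dom c0 p ->
  Num.sqrt (frame_sqdist p) = Num.sqrt (qform G (chart_coord c0 p - y0)) / S.
Proof.
move=> cp; rewrite frame_sqdistE// sqrtrM ?qform_ge0// sqrtrV ?sqr_ge0//.
by rewrite sqrtr_sqr (ger0_norm (ltW S0)).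
Qed.

Lemma compact_frame : compact [set y : 'rV[R]_n | qform G (y - y0) <= S ^+ 2].
Proof.
have [k k0 kG] := qform_lower Gp.
apply: bounded_closed_compact.
  exists (Num.sqrt (S ^+ 2 / k) + `|y0|); split; first exact: num_real.
  move=> N /ltW hN y /= yS; apply: le_trans hN.
  rewrite -[y in leLHS](subrK y0) (le_trans (ler_normD _ _))// lerD2r.
  rewrite -[leLHS]ger0_norm// -sqrtr_sqr ler_sqrt ?divr_ge0 ?sqr_ge0 ?(ltW k0)//.
  by rewrite ler_pdivlMr// mulrC (le_trans (kG _)).
rewrite (_ : mkset _ = (fun y => qform G (y - y0)) @^-1` [set s | s <= S ^+ 2]) //.
apply: closed_comp => [y _|]; last exact: closed_le.
exact: (differentiable_continuous (C1_on_qform Gp y0 (I : setT y)).1).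
Qed.

Let K : set M := chart_param c0 @` [set y : 'rV[R]_n | qform G (y - y0) <= S ^+ 2].

Let closedK : closed K.
Proof.
apply: compact_closed; first exact: manifold_hausdorff X.
apply: continuous_compact; last exact: compact_frame.
have [_ _ _ yP] := fr.
move=> y; apply: (@continuous_in_subspaceT _ _ _ (chart_param c0)) => z.
rewrite inE => /yP [iz _]; exact: continuous_param Xc0 _ iz.
Qed.

Lemma frame_bump_eq0 m p : ~ K p -> frame_bump m p = 0.
Proof.
move=> Kp; rewrite /frame_bump pospart_neg ?expr0n// subr_le0.
rewrite /frame_sqdist; case: ifPn => // /asboolP cp.
rewrite ler_pdivlMr ?exprn_gt0// mul1r leNgt; apply/negP => /ltW pS.
by apply: Kp; exists (chart_coord c0 p) => //; exact: chart_coordK Xc0 _ cp.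
Qed.

Section InChart.
Variables (m : nat) (c : chart R M n) (Xc : atlas X c).

Let frame_bump_near_overlap y : overlap c c0 y ->
  \forall z \near y, (frame_bump m \o chart_param c) z =
    (quadratic_bump G y0 S m \o transition c c0) z.
Proof.
move=> oy; apply: filterS (open_nbhs_nbhs (conj (open_overlap Xc Xc0) oy)).
move=> _ [p [cp c0p] <-] /=.
by rewrite /frame_bump /transition (chart_coordK Xc)// frame_sqdistE.
Qed.

Let frame_bump_near_outside y : chart_img c y -> ~ K (chart_param c y) ->
  \forall z \near y, (frame_bump m \o chart_param c) z = 0.
Proof.
move=> iy Ky; have oK : open (~` K) by exact: closed_openC.
have nK : \forall z \near y, ~ K (chart_param c z).
  exact: continuous_param Xc _ iy _ (open_nbhs_nbhs (conj oK Ky)).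
by apply: filterS nK => z /=; exact: frame_bump_eq0.
Qed.

Let chart_img_cases y : chart_img c y ->
  overlap c c0 y \/ (~ chart_dom c0 (chart_param c y) /\ ~ K (chart_param c y)).
Proof.
move=> iy; have [c0y|c0y] := pselect (chart_dom c0 (chart_param c y)).
  left; exists (chart_param c y); last exact: chart_paramK Xc _ iy.
  by split => //; exact: chart_dom_param Xc _ iy.
right; split => // -[z zS zy]; apply: c0y; rewrite -zy.
have [_ _ _ yP] := fr; have [iz _] := yP z zS.
exact: chart_dom_param Xc0 _ iz.
Qed.

(** The set K is closed in M, since M is Hausdorff, and lies inside the chart c0.
So around every point either c0 is available or the bump vanishes. *)
Lemma C1_frame_bump_chart : C1_on (chart_img c) (frame_bump m \o chart_param c).
Proof.
move=> y iy; have [oy|[_ Ky]] := chart_img_cases iy.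
  have oo := open_overlap Xc Xc0.
  apply: (@C1_on_near _ _ (overlap c c0) _ (quadratic_bump G y0 S m \o transition c c0)) => //.
  apply: (@C1_on_map _ _ _ _ setT) => //.
    by move=> k; exact: C1_transition Xc Xc0.
  exact: C1_quadratic_bump.
apply: (@C1_on_near _ _ [set y | chart_img c y /\ ~ K (chart_param c y)] _ (cst 0)) => //.
  by move=> z [iz Kz]; exact: frame_bump_near_outside.
exact: C1_on_cst.
Qed.

(** The Cauchy-Schwarz inequality for G; the factor sigma converts G back to the
metric. *)
Lemma derive_frame_bump_le p v : chart_dom c p ->
  `|'D_v (frame_bump m \o chart_param c) (chart_coord c p)| <=
  m.+2%:R * pospart (1 - frame_sqdist p) ^+ m.+1 *
  (2 / S * Num.sqrt (frame_sqdist p)) *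
  Num.sqrt (sigma * qform (g c (chart_coord c p)) v).
Proof.
move=> cp; have iy := chart_img_coord cp.
have rhs0 : 0 <= m.+2%:R * pospart (1 - frame_sqdist p) ^+ m.+1 *
    (2 / S * Num.sqrt (frame_sqdist p)) *
    Num.sqrt (sigma * qform (g c (chart_coord c p)) v).
  by rewrite !mulr_ge0 ?exprn_ge0 ?pospart_ge0 ?sqrtr_ge0 ?invr_ge0 ?(ltW S0).
have [oy|[_ Ky]] := chart_img_cases iy; last first.
  by rewrite (near_eq_derive _ (frame_bump_near_outside iy Ky)) derive_cst normr0.
have c0p : chart_dom c0 p.
  move: oy => [p' [cp' c0p'] E].
  by rewrite -(chart_coordK Xc cp) -E (chart_coordK Xc cp').
have tp : transition c c0 (chart_coord c p) = chart_coord c0 p.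
  by rewrite /transition (chart_coordK Xc).
rewrite (near_eq_derive _ (frame_bump_near_overlap oy)).
have [|_ ->] := @is_derive_map _ _ _ (transition c c0) (quadratic_bump G y0 S m)
    (chart_coord c p) v (fun k => (C1_transition k Xc Xc0 oy).1).
  exact: (C1_quadratic_bump Gp _ _ _ (I : setT _)).1.
rewrite (derive_transition _ Xc Xc0)// tp derive_quadratic_bump//.
set w := v *m _; rewrite -frame_sqdistE//.
have [q1|q1] := leP 1 (frame_sqdist p).
  by rewrite pospart_neg ?subr_le0// expr0n !(mulr0, mul0r) oppr0 normr0.
have [_ _ _ yP] := fr.
have pS : qform G (chart_coord c0 p - y0) <= S ^+ 2.
  by move: q1; rewrite frame_sqdistE// ltr_pdivrMr ?exprn_gt0// mul1r => /ltW.
have [_ /(_ w) [_ wG]] := yP _ pS.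
rewrite (qform_change_chart hg v Xc Xc0 cp c0p) in wG.
rewrite normrN normrM ger0_norm ?mulr_ge0 ?exprn_ge0 ?pospart_ge0// -[leRHS]mulrA.
rewrite ler_wpM2l ?mulr_ge0 ?exprn_ge0 ?pospart_ge0//.
rewrite !normrM normfV (ger0_norm (sqr_ge0 S)) (ger0_norm (ler0n _ 2)).
have CS := bform_cauchy_schwarz (chart_coord c0 p - y0) w Gp.
rewrite ler_pdivrMr ?exprn_gt0//.
apply: (@le_trans _ _ (2 * (Num.sqrt (qform G (chart_coord c0 p - y0)) *
    Num.sqrt (sigma * qform (g c (chart_coord c p)) v)))).
  rewrite ler_wpM2l// (le_trans CS)// ler_wpM2l ?sqrtr_ge0//.
  exact: ler_wsqrtr.
rewrite sqrt_frame_sqdist//.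
rewrite le_eqVlt; apply/orP; left; apply/eqP.
by field; rewrite gt_eqF.
Qed.

End InChart.

Lemma C1_frame_bump m : C1_fun X (frame_bump m).
Proof. by move=> c Xc; exact: C1_frame_bump_chart. Qed.

End FrameBump.

(** * A C^1 cutoff with controlled gradient *)

Section LogSum.
Variable R : realType.

Lemma derive_sum_seq m (I : Type) (s : seq I) (a : I -> R)
    (F : I -> 'rV[R]_m -> R) x v : (forall i, derivable (F i) x v) ->
  is_derive x v (fun y => \sum_(i <- s) a i * F i y) (\sum_(i <- s) a i * 'D_v (F i) x).
Proof.
move=> dF; elim: s => [|i s IH].
  by under eq_fun do rewrite big_nil; rewrite big_nil; exact: is_derive_cst.
under eq_fun do rewrite big_cons; rewrite big_cons.
have di : is_derive x v (fun y => a i * F i y) (a i * 'D_v (F i) x).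
  by split; [exact: derivableZ|rewrite -[RHS]/(a i *: _) -deriveZ].
by split; [exact: derivableD|rewrite deriveD//; case: di => _ ->; case: IH => _ ->].
Qed.

Section Log.
Variables (m : nat) (k : R) (U : set 'rV[R]_m) (f : 'rV[R]_m -> R).
Hypotheses (oU : open U) (Cf : C1_on U f) (f0 : forall y, U y -> 0 <= f y).

Let p (s : R) : R := k * ln (1 + s).

Let fN1 y : U y -> -1 < f y.
Proof. by move=> /f0 fy; lra. Qed.

Let dp (s : R) : -1 < s -> is_derive s (1 : R) p (k / (1 + s)).
Proof.
move=> s0; have s1 : 0 < 1 + s by lra.
have [da daE] : is_derive s (1 : R) (fun a : R => 1 + a) 1.
  have := is_derive_affine (1 : R) (1 : R) s.
  by rewrite (_ : (fun a : R => _) = (fun a : R => 1 + a))//;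
    apply/funext => a; rewrite addrC [_%:A]mulr1.
have d1 : differentiable (fun a : R => 1 + a) s by apply/derivable1_diffP.
have dl : differentiable (@ln R) (1 + s).
  by apply/derivable1_diffP; case: (is_derive1_ln s1).
have dc : derivable (@ln R \o (fun a : R => 1 + a)) s 1.
  by apply: diff_derivable; exact: differentiable_comp.
split; first exact: (derivableZ dc).
have -> : 'D_1 p s = k * 'D_1 (@ln R \o (fun a : R => 1 + a)) s.
  by rewrite -[RHS]/(k *: _) -deriveZ.
congr (_ * _); rewrite -derive1E derive1_comp.
- rewrite derive1E; case: (is_derive1_ln s1) => _ ->.
  by rewrite derive1E daE mulr1.
- exact: da.
- by case: (is_derive1_ln s1).
Qed.

Lemma C1_on_log : C1_on U (fun y => k * ln (1 + f y)).
Proof.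
apply: (C1_on_comp (p := p)) => // y Uy; split.
  by case: (dp (fN1 Uy)).
have fy := fN1 Uy.
apply: (@continuous_near_eq _ _ _ (fun s : R => k * (1 + s)^-1)).
  near=> s; rewrite derive1E; have s1 : -1 < s.
    by near: s; exact: lt_nbhsr.
  by case: (dp s1).
apply: cvgM; first exact: cvg_cst.
apply: cvgV; first by lra.
by apply: cvgD; [exact: cvg_cst|exact: cvg_id].
Unshelve. all: by end_near. Qed.

Lemma derive_log y v : U y ->
  'D_v (fun y => k * ln (1 + f y)) y = k / (1 + f y) * 'D_v f y.
Proof.
move=> Uy; have [dp1 dpE] := dp (fN1 Uy).
by have [_ ->] := is_derive_comp v (Cf Uy).1 dp1; rewrite derive1E dpE.
Qed.

End Log.

(** One term of the gradient of the logarithm of a sum of weighted bumps. Here z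
is the squared distance to the centre of the bump, a its weight, and b^(k + 2)
bounds the whole sum. If sqrt z <= 1/4 then sqrt z <= 4/15 (1 - z), and the
term is at most 4/15 of the bump. If sqrt z >= 1/4, then 1 - z <= exp (- z)
decays faster than a can exceed b: the exponent
(sqrt z + 1/100) 2/9 + 2 / 100^2 - z is at most - 1/250, and raising it to a
high power makes the term negligible. *)
Lemma bump_term_le (k : nat) (a b z : R) : 0 <= a -> 0 <= z -> z < 1 ->
  a <= b * expR ((Num.sqrt z + 1 / 100) * (2 / 9) + 2 * (1 / 100) ^+ 2) ->
  a ^+ k.+2 * ((1 - z) ^+ k.+1 * Num.sqrt z) <=
  4 / 15 * (a ^+ k.+2 * (1 - z) ^+ k.+2) +
  expR 1 * expR (- (1 / 250)) ^+ k.+1 * b ^+ k.+2.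
Proof.
move=> a0 z0 z1; set E := expR _ => ab.
have E0 : 0 < E by exact: expR_gt0.
have b0 : 0 <= b by rewrite -(pmulr_lge0 b E0) (le_trans a0).
set s := Num.sqrt z; have s0 : 0 <= s by exact: sqrtr_ge0.
have zE : z = s ^+ 2 by rewrite sqr_sqrtr.
have z10 : 0 <= 1 - z by lra.
have [s4|s4] := leP s (1 / 4).
  apply: (@le_trans _ _ (4 / 15 * (a ^+ k.+2 * (1 - z) ^+ k.+2))); last first.
    by rewrite lerDl; apply: mulr_ge0; [apply: mulr_ge0|]; rewrite ?exprn_ge0 ?expR_ge0.
  have sz : s <= 4 / 15 * (1 - z) by rewrite zE; nra.
  rewrite [(1 - z) ^+ k.+2]exprSr; set A := a ^+ _; set P := (1 - z) ^+ _.
  have AP : 0 <= A * P by rewrite mulr_ge0 ?exprn_ge0.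
  by have := ler_wpM2l AP sz; lra.
have s1 : s < 1 by rewrite -(expr_lt1 (n := 2))// -zE.
apply: (@le_trans _ _ (expR 1 * expR (- (1 / 250)) ^+ k.+1 * b ^+ k.+2)); last first.
  by rewrite lerDr; apply: mulr_ge0; [|apply: mulr_ge0]; rewrite ?exprn_ge0 ?expR_ge0.
apply: (@le_trans _ _ ((b * E) ^+ k.+2 * (1 - z) ^+ k.+1)).
  have P0 : 0 <= (1 - z) ^+ k.+1 by exact: exprn_ge0.
  apply: ler_pM; [exact: exprn_ge0|exact: mulr_ge0| |].
    by apply: lerXn2r; rewrite ?nnegrE// (le_trans a0).
  by rewrite ler_piMr// ltW.
have -> : (b * E) ^+ k.+2 * (1 - z) ^+ k.+1 = E * (E * (1 - z)) ^+ k.+1 * b ^+ k.+2.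
  by rewrite !exprMn [E ^+ k.+2]exprS; ring.
rewrite ler_wpM2r ?exprn_ge0//.
apply: ler_pM; [exact: ltW|by rewrite exprn_ge0// mulr_ge0// ltW| |].
  by rewrite /E ler_expR -/s; lra.
apply: lerXn2r; rewrite ?nnegrE ?mulr_ge0 ?(ltW E0) ?expR_ge0//.
apply: (@le_trans _ _ (E * expR (- z))).
  by rewrite ler_wpM2l ?(ltW E0)//; have := expR_ge1Dx (- z).
rewrite /E -expRD ler_expR -/s zE; nra.
Qed.

End LogSum.

Section Cutoff.
Variables (R : realType) (M : ptopologicalType) (n : nat).
Variable X : smooth_structure R M n.
Variables (g : metric_tensor R M n) (hg : is_riemannian X g).
Hypothesis cM : compact [set: M].
Local Notation chart := (chart R M n).

Lemma frame_sqdist_lt1 sigma (c : chart) G q (S : R) x p :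
  frame X g sigma c G q S -> 0 < S -> frame_sqdist c G q S p < 1 ->
  (riem_dist X g x p <=
     riem_dist X g x q + (S * Num.sqrt (frame_sqdist c G q S p))%:E)%E /\
  (riem_dist X g x q <=
     riem_dist X g x p + (S * Num.sqrt (frame_sqdist c G q S p))%:E)%E.
Proof.
move=> fr S0 p1; have cp : chart_dom c p.
  by move: p1; rewrite /frame_sqdist; case: ifPn => [/asboolP//|]; rewrite ltxx.
rewrite (sqrt_frame_sqdist fr S0 cp) mulrCA mulfV ?gt_eqF// mulr1.
apply: (frame_dist fr) => //.
move: p1; rewrite frame_sqdistE// ltr_pdivrMr ?exprn_gt0// mul1r.
exact: ltW.
Qed.

Section Net.
Variables (sigma S : R) (cf : M -> chart) (Gf : M -> 'M[R]_n).
Hypotheses (S0 : 0 < S) (fr : forall q, frame X g sigma (cf q) (Gf q) q S).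

Let z q p : R := frame_sqdist (cf q) (Gf q) q S p.

Lemma frame_net (t : R) : 0 < t -> exists s : seq M, forall p,
  exists2 q, q \in s & z q p < t ^+ 2.
Proof.
move=> t0; have tS : 0 < t ^+ 2 * S ^+ 2 by rewrite mulr_gt0 ?exprn_gt0.
have := cM; rewrite compact_cover => /(_ M setT (fun q => [set p | z q p < t ^+ 2]°)).
case.
- by move=> q _; exact: open_interior.
- move=> q _; exists q => //=; rewrite /interior/=.
  have := frame_nbhs (fr q) tS; apply: filterS => p [cp pt] /=.
  by rewrite /z frame_sqdistE// ltr_pdivrMr ?exprn_gt0.
- move=> D _ cov; exists (finmap.enum_fset D) => p; have [q /= qD qp] := cov p I.
  by exists q => //; exact: (interior_subset qp).
Qed.

End Net.

(** A C^1 substitute for the tent function max (0, r - dist x), which is only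
Lipschitz. For points q of a fine net let a_q = exp ((r' - dist x q) / kappa),
and let w_q be the bump 1 - z_q in the frame at q, z_q being the squared
distance to q in units of the frame radius S. Then
u = (kappa / m) ln (1 + sum_q (a_q w_q)^m), for large m, is close to the
maximum over q of r' - dist x q + kappa ln w_q and 0. Its gradient is a
weighted mean of the gradients of kappa ln w_q, and the weights concentrate on
the points q close to p, where these gradients are small: a distant bump loses
more from w_q than it gains from a_q. The constants are chosen so that the
gradient is at most 9 (4/15 + 1/200) 51/50 < 5/2, the last factor being the
distortion of the frames. *)
Lemma cutoff_exists x (r : R) : 0 < r -> exists u : M -> R,
  [/\ C1_fun X u, forall p, 0 <= u p,
      forall p, ~ geodesic_ball X g x r p ->
        u p = 0 /\ covector_sqnorm X g (diff_form u) p <= 0,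
      forall p, geodesic_ball X g x (r / 2) p -> 49 / 100 * r <= u p &
      forall p, covector_sqnorm X g (diff_form u) p <= (5 / 2) ^+ 2].
Proof.
move=> r0; pose sigma : R := 26 / 25.
have sigma1 : 1 < sigma by rewrite /sigma; lra.
have r500 : 0 < r / 500 by lra.
have [S [S0 Sr frS]] := frames_exist_lt hg cM sigma1 r500.
have Sfr q : exists cG : chart * 'M[R]_n, frame X g sigma cG.1 cG.2 q S.
  by have [c [G fr]] := frS q; exists (c, G).
have [cG fr] := choice Sfr.
pose z q p := frame_sqdist (cG q).1 (cG q).2 q S p.
have z0 q p : 0 <= z q p by exact: (frame_sqdist_ge0 (fr q)).
have t0 : 0 < 1 / 100 :> R by lra.
have [net netP] := frame_net S0 fr t0.
(* A frame around a point closer to x than r' stays inside the ball. *)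
pose r' := r - S.
pose s := [seq q <- net | (riem_dist X g x q < r'%:E)%E].
pose N : R := (size s)%:R.
pose lam : R := expR (- (1 / 250)).
(* The power has to beat the number N of net points. *)
have [k kN] : exists k, N * expR 1 * lam ^+ k.+1 <= 1 / 200.
  pose k := Num.truncn (N * expR 1 * 250 * 200); exists k.
  have kN : N * expR 1 * 250 * 200 < k.+1%:R by exact: truncnS_gt.
  have k0 : 0 < k.+1%:R :> R by rewrite ltr0Sn.
  have Ne0 : 0 <= N * expR 1 by rewrite mulr_ge0// expR_ge0.
  rewrite /lam -expRM_natl mulrN expRN ler_pdivrMr ?expR_gt0//.
  have := expR_ge1Dx (k.+1%:R * (1 / 250) : R); lra.
pose kappa := 9 / 2 * S.
have kappa0 : 0 < kappa by rewrite mulr_gt0.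
pose f q := fine (riem_dist X g x q).
have fE q : (riem_dist X g x q < +oo)%E -> riem_dist X g x q = (f q)%:E.
  by move=> dq; rewrite fineK// ge0_fin_numE// riem_dist_ge0.
pose a q := expR ((r' - f q) / kappa).
have a0 q : 0 < a q by exact: expR_gt0.
pose W p := \sum_(q <- s) a q ^+ k.+2 * frame_bump (cG q).1 (cG q).2 q S k p.
have b0 q p : 0 <= frame_bump (cG q).1 (cG q).2 q S k p.
  by rewrite exprn_ge0// pospart_ge0.
have W0 p : 0 <= W p.
  by apply: sumr_ge0 => q _; rewrite mulr_ge0// exprn_ge0// ltW.
have bC q : C1_fun X (frame_bump (cG q).1 (cG q).2 q S k) by exact: C1_frame_bump.
have WC : C1_fun X W.
  move=> c Xc; have oc := open_chart_img Xc.
  apply: (@C1_on_sum _ _ (chart_img c) M s (fun q => cst (a q ^+ k.+2) \*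
    (frame_bump (cG q).1 (cG q).2 q S k \o chart_param c))) => // q.
  by apply: C1_onM; [|exact: C1_on_cst|exact: bC].
pose l := kappa / k.+2%:R.
have l0 : 0 < l by rewrite divr_gt0// ltr0Sn.
pose u p := l * ln (1 + W p).
have uC : C1_fun X u.
  move=> c Xc; apply: (@C1_on_log _ _ l (chart_img c) (W \o chart_param c)).
  - exact: open_chart_img Xc.
  - exact: WC.
  - by move=> y _; exact: W0.
have du c v p : atlas X c -> chart_dom c p ->
    `|'D_v (u \o chart_param c) (chart_coord c p)| <=
    9 / (1 + W p) * (\sum_(q <- s) a q ^+ k.+2 *
       (pospart (1 - z q p) ^+ k.+1 * Num.sqrt (z q p))) *
    Num.sqrt (sigma * qform (g c (chart_coord c p)) v).
  move=> Xc cp; have iy := chart_img_coord cp.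
  have -> : 'D_v (u \o chart_param c) (chart_coord c p) =
      l / (1 + W p) * 'D_v (W \o chart_param c) (chart_coord c p).
    rewrite (@derive_log _ _ l (chart_img c) (W \o chart_param c) (WC c Xc))//=.
    by rewrite (chart_coordK Xc cp).
  have [|_ ->] := @derive_sum_seq _ _ _ s (fun q => a q ^+ k.+2)
      (fun q => frame_bump (cG q).1 (cG q).2 q S k \o chart_param c)
      (chart_coord c p) v.
    by move=> q; apply: diff_derivable; have [] := bC q c Xc _ iy.
  have W1 : 0 < 1 + W p by rewrite ltr_wpDr.
  have c10 : 0 <= l / (1 + W p) by rewrite mulr_ge0 ?invr_ge0 ?(ltW l0) ?(ltW W1).
  rewrite normrM (ger0_norm c10).
  set Q := Num.sqrt _.
  have -> : 9 / (1 + W p) = l / (1 + W p) * (k.+2%:R * (2 / S)).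
    by rewrite /l /kappa; field; rewrite !gt_eqF ?ltr0Sn.
  move: c10; set c1 := l / (1 + W p) => c10.
  rewrite -2!(mulrA c1) ler_wpM2l//.
  rewrite (le_trans (ler_norm_sum _ _ _))// mulr_sumr mulr_suml ler_sum// => q _.
  rewrite normrM ger0_norm ?exprn_ge0 ?(ltW (a0 q))//.
  have := derive_frame_bump_le hg (fr q) S0 k Xc v cp; rewrite -/Q.
  move=> /(ler_wpM2l (exprn_ge0 k.+2 (ltW (a0 q)))) /le_trans; apply.
  rewrite le_eqVlt; apply/orP; left; apply/eqP; rewrite /z; ring.
have near_ball p q : (riem_dist X g x q < r'%:E)%E -> z q p < 1 -> geodesic_ball X g x r p.
  move=> qr zq; have [+ _] := frame_sqdist_lt1 x (fr q) S0 zq.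
  have qfin : (riem_dist X g x q < +oo)%E by rewrite (lt_trans qr)// ltry.
  rewrite (fE q qfin) lte_fin in qr *; move=> /le_lt_trans; apply.
  rewrite -EFinD lte_fin; rewrite /r' in qr.
  have : S * Num.sqrt (z q p) <= S by rewrite ler_piMr ?(ltW S0)// -sqrtr1 ler_sqrt ltW.
  lra.
have zball p : ~ geodesic_ball X g x r p -> {in s, forall q, 1 <= z q p}.
  move=> pr q; rewrite mem_filter => /andP[qr _].
  by rewrite leNgt; apply/negP => /(near_ball p q qr).
have zexp j p : z j p < (1 / 100) ^+ 2 ->
    0 <= 1 - z j p /\ expR (- (2 * (1 / 100) ^+ 2)) <= 1 - z j p.
  move=> zj; split; first lra.
  have := expR_ge1Dx (2 * (1 / 100) ^+ 2 : R); set y := 2 * _ => ey.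
  rewrite expRN -[leLHS]mul1r ler_pdivrMr ?expR_gt0//.
  have zj1 : 0 < 1 - z j p by lra.
  have := ler_wpM2l (ltW zj1) ey; rewrite /y; nra.
have W_ge j p : j \in s -> z j p < 1 -> (a j * (1 - z j p)) ^+ k.+2 <= W p.
  move=> js zj; rewrite /W (big_rem j)//= /frame_bump pospart_pos; last first.
    by rewrite subr_ge0 ltW.
  rewrite -exprMn lerDl sumr_ge0// => q _.
  by rewrite mulr_ge0 ?exprn_ge0 ?pospart_ge0 ?(ltW (a0 q)).
have dist_net j p : z j p < (1 / 100) ^+ 2 ->
    (riem_dist X g x j <= riem_dist X g x p + (S / 100)%:E)%E.
  move=> zj; have zj1 : z j p < 1 by lra.
  have [_ /le_trans] := frame_sqdist_lt1 x (fr j) S0 zj1; apply.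
  rewrite leeD2l// lee_fin ler_wpM2l ?(ltW S0)//.
  have t1 : 0 <= 100^-1 :> R by lra.
  rewrite -(ger0_norm t1) -sqrtr_sqr ler_sqrt ?sqr_ge0//.
  by move: zj; rewrite /z; lra.
(* The witness is the bump of a net point j close to p if j carries one, and the
   summand 1 of 1 + W otherwise. *)
have dominating p : exists2 b : R, b ^+ k.+2 <= 1 + W p & {in s, forall q, z q p < 1 ->
    a q <= b * expR ((Num.sqrt (z q p) + 1 / 100) * (2 / 9) + 2 * (1 / 100) ^+ 2)}.
  have [j jnet zj] := netP p; rewrite -/(z j p) in zj.
  have zj1 : z j p < 1 by lra.
  have [zj0 zje] := zexp j p zj.
  have jq q : q \in s -> z q p < 1 -> (riem_dist X g x j <=
      (f q + S * Num.sqrt (z q p) + S / 100)%:E)%E /\ f q < r'.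
    rewrite mem_filter => /andP[qr _] zq.
    have qfin : (riem_dist X g x q < +oo)%E by rewrite (lt_trans qr)// ltry.
    rewrite fE// lte_fin in qr; split => //.
    rewrite (le_trans (dist_net j p zj))// [in leRHS]EFinD leeD2r//.
    by have [+ _] := frame_sqdist_lt1 x (fr q) S0 zq; rewrite (fE q qfin).
  have [jr|jr] := boolP (riem_dist X g x j < r'%:E)%E.
    have js : j \in s by rewrite mem_filter jr.
    exists (a j * (1 - z j p)); first by rewrite (le_trans (W_ge j p js zj1))// lerDr.
    move=> q qs zq; have [djq _] := jq q qs zq.
    rewrite fE ?(lt_trans jr) ?ltry// lee_fin in djq.
    rewrite [_ + 2 * _]addrC expRD mulrA.
    have Ej : 1 <= (1 - z j p) * expR (2 * (1 / 100) ^+ 2).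
      rewrite -ler_pdivrMr ?expR_gt0//.
      by rewrite expRN -[leLHS]mul1r in zje.
    apply: (@le_trans _ _ (a j * expR ((Num.sqrt (z q p) + 1 / 100) * (2 / 9)))).
      rewrite -expRD ler_expR.
      rewrite -(ler_pM2r kappa0) (mulrDl (_ / kappa)) !(divfK (lt0r_neq0 kappa0)).
      by rewrite /kappa; lra.
    rewrite ler_wpM2r ?expR_ge0// -mulrA.
    by rewrite ler_peMr// ltW.
  exists 1; first by rewrite expr1n lerDl.
  move=> q qs zq; have [djq _] := jq q qs zq.
  rewrite mul1r ler_expR.
  have : r' <= f q + S * Num.sqrt (z q p) + S / 100.
    by rewrite -lee_fin (le_trans _ djq)// leNgt.
  move=> rj; rewrite ler_pdivrMr// /kappa; nra.
exists u; split => //.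
- by move=> p; rewrite mulr_ge0 ?(ltW l0)// ln_ge0// lerDl.
- move=> p pr; have zp := zball p pr; split.
    rewrite /u (_ : W p = 0) ?addr0 ?ln1 ?mulr0//.
    rewrite /W big_seq big1// => q qs.
    by rewrite /frame_bump pospart_neg ?expr0n ?mulr0// subr_le0; exact: zp.
  rewrite -[leRHS](expr0n _ 2); apply: covector_sqnorm_le => // c v Xc cp.
  rewrite mul0r (le_trans (du c v p Xc cp))// big_seq big1 ?mulr0 ?mul0r// => q qs.
  by rewrite pospart_neg ?expr0n ?(mulr0, mul0r)// subr_le0; exact: zp.
- move=> p pr; have [j jnet zj] := netP p; rewrite -/(z j p) in zj.
  have zj1 : z j p < 1 by lra.
  have [zj0 zje] := zexp j p zj.
  have pfin : (riem_dist X g x p < +oo)%E by rewrite (lt_trans pr)// ltry.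
  have jr2 : (riem_dist X g x j < (r / 2 + S / 100)%:E)%E.
    rewrite (le_lt_trans (dist_net j p zj))// EFinD lte_leD//.
  have js : j \in s.
    rewrite mem_filter jnet andbT (lt_le_trans jr2)// lee_fin /r'; lra.
  have jfin : (riem_dist X g x j < +oo)%E by rewrite (lt_trans jr2)// ltry.
  rewrite (fE j jfin) lte_fin in jr2.
  rewrite /u -ler_pdivrMl// -ler_expR lnK ?posrE ?ltr_wpDr//.
  rewrite (@le_trans _ _ ((a j * (1 - z j p)) ^+ k.+2))//; last first.
    by rewrite (le_trans (W_ge j p js zj1))// lerDr.
  have -> : l^-1 * (49 / 100 * r) = k.+2%:R * (49 / 100 * r / kappa).
    by rewrite /l; field; rewrite !gt_eqF ?ltr0Sn.
  rewrite expRM_natl lerXn2r ?nnegrE ?expR_ge0 ?mulr_ge0 ?(ltW (a0 j))//.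
  rewrite (@le_trans _ _ (a j * expR (- (2 * (1 / 100) ^+ 2))))//; last first.
    by rewrite ler_wpM2l// ltW.
  rewrite -expRD ler_expR -(ler_pM2r kappa0) (mulrDl (_ / kappa)).
  rewrite !(divfK (lt0r_neq0 kappa0)).
  rewrite /kappa /r'; lra.
- move=> p; have k52 : 0 <= 5 / 2 :> R by lra.
  apply: covector_sqnorm_le => // c v Xc cp.
  apply: (le_trans (du c v p Xc cp)).
  have [b bW ab] := dominating p.
  have W1 : 0 < 1 + W p by rewrite ltr_wpDr.
  have lam0 : 0 <= lam ^+ k.+1 by rewrite exprn_ge0// expR_ge0.
  have e0 : 0 <= expR 1 :> R by exact: expR_ge0.
  have sumW : \sum_(q <- s) a q ^+ k.+2 *
      (pospart (1 - z q p) ^+ k.+1 * Num.sqrt (z q p)) <=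
      (4 / 15 + 1 / 200) * (1 + W p).
    apply: (@le_trans _ _ (\sum_(q <- s) (4 / 15 * (a q ^+ k.+2 *
        frame_bump (cG q).1 (cG q).2 q S k p) + expR 1 * lam ^+ k.+1 * (1 + W p)))).
      rewrite big_seq [leRHS]big_seq; apply: ler_sum => q qs.
      rewrite /frame_bump -/(z q p); have [zq|zq] := leP 1 (z q p).
        rewrite pospart_neg ?subr_le0// !expr0n !(mulr0, mul0r) add0r.
        by rewrite mulr_ge0 ?mulr_ge0// ltW.
      rewrite pospart_pos; last by rewrite subr_ge0 ltW.
      rewrite (le_trans (bump_term_le k (ltW (a0 q)) (z0 q p) zq (ab q qs zq)))//.
      by rewrite lerD2l; apply: ler_wpM2l; [exact: mulr_ge0|exact: bW].
    rewrite big_split/= -mulr_sumr -/(W p) big_const_seq count_predT iter_addr_0.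
    rewrite -[_ *+ size s]mulr_natl -/N.
    have := ler_wpM2r (ltW W1) kN; have := W0 p; lra.
  have s1 : Num.sqrt sigma <= 51 / 50.
    have s0 : 0 <= 51 / 50 :> R by lra.
    by rewrite -(ger0_norm s0) -sqrtr_sqr ler_sqrt ?sqr_ge0// /sigma; lra.
  rewrite sqrtrM; last by rewrite /sigma; lra.
  set Q := Num.sqrt (qform _ _); have Q0 : 0 <= Q by exact: sqrtr_ge0.
  rewrite mulrA ler_wpM2r//.
  rewrite (@le_trans _ _ (9 * (4 / 15 + 1 / 200) * (51 / 50)))//; last by lra.
  rewrite ler_pM ?sqrtr_ge0//.
    rewrite mulr_ge0 ?divr_ge0 ?(ltW W1)// sumr_ge0// => q _.
    apply: mulr_ge0; first by rewrite exprn_ge0// ltW.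
    by rewrite mulr_ge0 ?exprn_ge0 ?pospart_ge0 ?sqrtr_ge0.
  by rewrite mulrAC ler_pdivrMr// -mulrA ler_wpM2l.
Unshelve. all: by end_near. Qed.

End Cutoff.

(** * Volumes of balls *)

Section CutoffIntegrals.
Context d (T : measurableType d) (R : realType) (mu : {measure set T -> \bar R}).

Lemma integral_indicZ (E : set T) (a : R) : measurable E -> 0 <= a ->
  (\int[mu]_p (a * \1_E p)%:E = a%:E * mu E)%E.
Proof.
move=> mE a0; under eq_integral do rewrite EFinM.
have mi : measurable_fun setT (fun p => (\1_E p)%:E : \bar R).
  by apply/measurable_EFinP; exact: measurable_indic.
by rewrite ge0_integralZl_EFin// integral_indic// setIT.
Qed.

Lemma integral_lt_pinfty (E : set T) (f : T -> R) (a : R) :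
  measurable E -> (mu E < +oo)%E -> 0 <= a ->
  (forall p, f p <= a * \1_E p) -> (\int[mu]_p (f p)%:E < +oo)%E.
Proof.
move=> mE Efin a0 fa; apply: (@le_lt_trans _ _ (\int[mu]_p (a * \1_E p)%:E)%E).
  by apply: le_integral_pointwise => p _; rewrite lee_fin.
by rewrite integral_indicZ// lte_mul_pinfty ?lee_fin.
Qed.

Lemma ge0_integral_indicD (E : set T) (f : T -> R) (a b : R) :
  measurable E -> measurable_fun setT f -> (forall p, 0 <= f p) ->
  0 <= a -> 0 <= b ->
  (\int[mu]_p (a * \1_E p + b * f p)%:E =
     a%:E * mu E + b%:E * \int[mu]_p (f p)%:E)%E.
Proof.
move=> mE mf f0 a0 b0.
under eq_integral do rewrite EFinD.
rewrite ge0_integralD//=; last 4 first.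
- by move=> p _; rewrite lee_fin mulr_ge0// indicE.
- by apply/measurable_EFinP; apply: measurable_funM => //; exact: measurable_indic.
- by move=> p _; rewrite lee_fin mulr_ge0.
- by apply/measurable_EFinP; apply: measurable_funM.
rewrite integral_indicZ//; congr (_ + _)%E.
under eq_integral do rewrite EFinM.
have mf' : measurable_fun setT (fun p => (f p)%:E) by exact/measurable_EFinP.
by rewrite ge0_integralZl_EFin//= => p _; rewrite lee_fin.
Qed.

(** Hölder's inequality for exponents 3 and 3/2 against the indicator of E,
obtained by integrating the weighted inequality between the means of
u^6, 1 and 1. *)
Lemma integral_sqr_le (E : set T) (u : T -> R) (N W : R) :
  measurable E -> measurable_fun setT u -> (forall p, ~ E p -> u p = 0) ->
  0 < N -> 0 < W -> mu E = (W ^+ 3)%:E ->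
  (\int[mu]_p (u p ^+ 6)%:E = (N ^+ 3)%:E)%E ->
  (\int[mu]_p (u p ^+ 2)%:E <= (N * W ^+ 2)%:E)%E.
Proof.
move=> mE mu_ u0 N0 W0 EW uN.
have a0 : 0 <= 2 / 3 * N / W by rewrite !mulr_ge0 ?invr_ge0 ?ltW//; lra.
have b0 : 0 <= (W / N) ^+ 2 / 3 by rewrite mulr_ge0 ?sqr_ge0//; lra.
have u60 p : 0 <= u p ^+ 6 by rewrite -[6%N]/(2 * 3)%N exprM exprn_ge0 ?sqr_ge0.
have mu6 : measurable_fun setT (fun p => u p ^+ 6) by exact: measurable_funX.
apply: (@le_trans _ _ (\int[mu]_p
    (2 / 3 * N / W * \1_E p + (W / N) ^+ 2 / 3 * u p ^+ 6)%:E)%E).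
  apply: le_integral_pointwise => p _; rewrite lee_fin indicE.
  have [_|pE] := boolP (p \in E); last first.
    rewrite u0; last by move=> Ep; rewrite mem_set in pE.
    by rewrite expr0n/= mulr0 add0r mulr_ge0.
  have -> : 2 / 3 * N / W = 2 / 3 / (W / N) by field; rewrite !gt_eqF.
  move: (W / N) (divr_gt0 W0 N0) => y y0.
  have -> : u p ^+ 6 = (u p ^+ 2) ^+ 3 by rewrite -exprM.
  have : 0 <= u p ^+ 2 by exact: sqr_ge0.
  move: (u p ^+ 2) => w w0.
  rewrite mulr1; have -> : 2 / 3 / y + y ^+ 2 / 3 * w ^+ 3 =
     (2 + (y * w) ^+ 3) / (3 * y) by field; rewrite gt_eqF.
  rewrite ler_pdivlMr ?mulr_gt0//.
  have : 0 <= (y * w - 1) ^+ 2 * (y * w + 2).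
    by rewrite mulr_ge0 ?sqr_ge0// addr_ge0// mulr_ge0// ltW.
  lra.
rewrite ge0_integral_indicD// EW uN -!EFinM -EFinD lee_fin le_eqVlt.
by apply/orP; left; apply/eqP; field; rewrite !gt_eqF.
Qed.

End CutoffIntegrals.

Lemma cube_root (R : realType) (y : R) : 0 <= y ->
  (y `^ (1 / 3)) ^+ 3 = y.
Proof. by move=> y0; rewrite -powR_mulrn ?powR_ge0// -powRrM mulfVK// powRr1. Qed.

(** Superexponential decay of e under e (m + 1) <= (e m)^3 is incompatible with
a positive lower bound. *)
Lemma cubic_recursion_ge1 (R : realType) (e : nat -> R) (e0 : R) :
  0 < e0 -> (\forall m \near \oo, e0 <= e m) -> (forall m, 0 <= e m) ->
  (forall m, e m.+1 <= e m ^+ 3) -> 1 <= e 0.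
Proof.
move=> e00 ee0 ege0 eS; rewrite leNgt; apply/negP => e1.
have eX m : e m <= e 0 ^+ m.+1.
  elim: m => [|m IH]; first by rewrite expr1.
  apply: (le_trans (eS m)); rewrite [leRHS]exprS.
  have e0m : e 0 ^+ m.+1 <= e 0.
    by rewrite exprS ler_piMr// exprn_ile1// ltW.
  rewrite exprS ler_pM ?sqr_ge0//; first exact: le_trans IH e0m.
  apply: (le_trans _ IH).
  by rewrite expr2 ler_piMr// (le_trans IH)// (le_trans e0m)// ltW.
have e01 : `|e 0| < 1 by rewrite ger0_norm.
have : \forall m \near \oo, e 0 ^+ m < e0.
  exact: (cvgr_lt 0 (cvg_expr e01) e0 e00).
move=> lt0; near \oo => m.
have : e0 < e0; last by rewrite ltxx.
apply: (@le_lt_trans _ _ (e 0 ^+ m)); last by near: m.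
apply: (@le_trans _ _ (e m)); first by near: m.
by rewrite (le_trans (eX m))// exprS ler_piMl ?exprn_ge0// ltW.
Unshelve. all: by end_near. Qed.

Section VolumeStep.
Variables (R : realType) (M : ptopologicalType) (X : smooth_structure R M 3).
Variables (g : metric_tensor R M 3) (hg : is_riemannian X g).
Hypothesis cM : compact [set: M].
Variables (vol : {measure set (borel M) -> \bar R}) (x : M).
Local Notation ball := (geodesic_ball X g x).
Local Notation V rho := (fine (vol (ball rho))).
Hypothesis ball_gt0 : forall rho : R, 0 < rho -> (0 < vol (ball rho))%E.
Variables (A B L r d : R).
Hypotheses (A0 : 0 < A) (B0 : 0 < B) (r0 : 0 < r) (rL : r <= L) (d0 : 0 < d).
Hypothesis sob : sobolev_inequality X g vol A B.
Hypothesis scal_le : forall y, ball r y -> scalar_curvature X g y <= 1 / r ^+ 2.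
Hypothesis dE : d ^+ 2 * (64 * A + 2 * B * L ^+ 2) = 1.
Hypothesis Vr : (vol (ball r) < ((d * r) ^+ 3)%:E)%E.

Lemma ball_volume_le (rho : R) : rho <= r ->
  (vol (ball rho) <= vol (ball r))%E.
Proof.
by move=> rr; apply: le_measure; rewrite ?inE;
  [exact: measurable_geodesic_ball|exact: measurable_geodesic_ball|exact: subset_geodesic_ball].
Qed.

Lemma ball_volume_fine (rho : R) : rho <= r -> vol (ball rho) = (V rho)%:E.
Proof.
move=> rr; rewrite fineK// ge0_fin_numE//.
by rewrite (le_lt_trans (ball_volume_le rr))// (lt_trans Vr)// ltry.
Qed.

Lemma ball_volume_gt0 (rho : R) : 0 < rho -> rho <= r -> 0 < V rho.
Proof. by move=> rho0 rr; rewrite -lte_fin -ball_volume_fine// ball_gt0. Qed.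

(** The Sobolev inequality for the cutoff of the ball of radius rho. The bound on
the scalar curvature and the smallness of the volume make the terms without
gradient a fraction of the left side, so that the sixth powers, hence the
volume of the ball of half the radius, are bounded by the gradient term, a
multiple of the volume of the ball of radius rho. With
e(rho) = V(rho) / (d rho)^3 the estimate reads e(rho / 2) <= e(rho)^3. *)
Lemma volume_halving (rho : R) : 0 < rho -> rho <= r ->
  8 * (d * rho) ^+ 6 * V (rho / 2) <= V rho ^+ 3.
Proof.
move=> rho0 rr; have [u [Cu u0 uoff uin ugrad]] := cutoff_exists hg cM x rho0.
have rho2r : rho / 2 <= r by lra.
have VE := ball_volume_fine rr; have V0 := ball_volume_gt0 rho0 rr.
have mE : measurable (ball rho : set (borel M)) by exact: measurable_geodesic_ball.
have Efin : (vol (ball rho) < +oo)%E by rewrite VE ltry.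
have uc : continuous u by exact: C1_fun_continuous Cu.
have mu_ : measurable_fun [set: borel M] (u : borel M -> R).
  apply: borel_continuous_measurable => [|p _]; [exact: openT|exact: uc].
have [K K0 uK] : exists2 K, 0 <= K & forall p, u p <= K.
  have : compact [set u p | p in [set: M]].
    by apply: continuous_compact => //; exact: continuous_subspaceT.
  move=> /compact_bounded[K [_ uK]]; exists (`|K| + 1) => // p.
  by rewrite -(ger0_norm (u0 p)); apply: uK; [rewrite ltr_pwDr// ler_norm|exists p].
have u_le j p : u p ^+ j.+1 <= K ^+ j.+1 * \1_(ball rho) p.
  rewrite indicE; have [_|pE] := boolP (p \in ball rho).
    by rewrite mulr1 lerXn2r ?nnegrE.
  rewrite mulr0 (_ : u p = 0) ?expr0n//.
  by have [|-> _] := uoff p; first by move=> Ep; rewrite mem_set in pE.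
have ufin j : (\int[vol]_p (u p ^+ j.+1)%:E < +oo)%E.
  by apply: (integral_lt_pinfty mE Efin _ (u_le j)); rewrite exprn_ge0.
have W12 : in_W12 X g vol u (diff_form u).
  split => //.
  - exact: diff_form_covector_field.
  - exact: diff_form_weak_differential.
  - apply: (integral_lt_pinfty mE Efin (sqr_ge0 (5 / 2))) => p.
    rewrite indicE; have [_|pE] := boolP (p \in ball rho).
      by rewrite mulr1.
    rewrite mulr0.
    by have [|_ ->] := uoff p; first by move=> Ep; rewrite mem_set in pE.
have uint j : exists2 I, 0 <= I & (\int[vol]_p (u p ^+ j.+1)%:E = I%:E)%E.
  have I0 : (0 <= \int[vol]_p (u p ^+ j.+1)%:E)%E.
    by apply: integral_ge0 => p _; rewrite lee_fin exprn_ge0.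
  exists (fine (\int[vol]_p (u p ^+ j.+1)%:E)%E); first exact: fine_ge0.
  by rewrite fineK// ge0_fin_numE.
have [I6 _ I6E] := uint 5%N; have [I2 I20 I2E] := uint 1%N.
have I6_ge : (49 / 100 * rho) ^+ 6 * V (rho / 2) <= I6.
  have c0 : 0 <= (49 / 100 * rho) ^+ 6 by rewrite exprn_ge0// mulr_ge0 ?ltW//; lra.
  rewrite -lee_fin -I6E EFinM -(ball_volume_fine rho2r) -integral_indicZ//; last first.
    exact: measurable_geodesic_ball.
  apply: le_integral_pointwise => p _; rewrite lee_fin indicE.
  have [/set_mem pE|_] := boolP (p \in ball (rho / 2)); last first.
    by rewrite mulr0 exprn_ge0.
  by rewrite mulr1 lerXn2r ?nnegrE ?uin// mulr_ge0 ?ltW//; lra.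
have I6_gt0 : 0 < I6.
  apply: lt_le_trans I6_ge; rewrite mulr_gt0 ?exprn_gt0//; first by lra.
  by apply: ball_volume_gt0 => //; lra.
pose N := I6 `^ (1 / 3); pose W := V rho `^ (1 / 3).
have N3 : N ^+ 3 = I6 by apply: cube_root; exact: ltW.
have W3 : W ^+ 3 = V rho by apply: cube_root; exact: ltW.
have N0 : 0 < N by exact: powR_gt0.
have W0 : 0 < W by exact: powR_gt0.
have u2 : (\int[vol]_p (u p ^+ 2)%:E <= (N * W ^+ 2)%:E)%E.
  apply: (integral_sqr_le mE) => //; rewrite ?N3 ?W3//.
  by move=> p /uoff[].
rewrite I2E lee_fin in u2.
have : N <= A * ((5 / 2) ^+ 2 * V rho + 1 / (4 * r ^+ 2) * I2) + B * I2.
  have e1 : 3%:R - 2 = 1 :> R by ring.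
  have := sob W12.
  have -> : (\int[vol]_p (`|u p| `^ (2 * 3%:R / (3%:R - 2)))%:E = (N ^+ 3)%:E)%E.
    rewrite N3 -I6E; apply: eq_integral => p _; rewrite ger0_norm//.
    by rewrite e1 divr1 -natrM powR_mulrn.
  have -> : ((N ^+ 3)%:E `^ ((3%:R - 2) / 3%:R) = N%:E)%E.
    by rewrite N3 poweR_EFin e1.
  rewrite I2E => /le_trans h; rewrite -lee_fin; apply: h.
  rewrite EFinD !EFinM leeD2r// lee_pmul2l ?lte_fin//.
  have c2 : 0 <= 1 / (4 * r ^+ 2) by rewrite divr_ge0// mulr_ge0// sqr_ge0.
  rewrite EFinD !EFinM -VE -I2E -EFinM -ge0_integral_indicD ?sqr_ge0//; last 2 first.
  - exact: measurable_funX.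
  - by move=> p; rewrite sqr_ge0.
  apply: le_integral_pointwise => p _; rewrite lee_fin indicE.
  have [/set_mem pE|pE] := boolP (p \in ball rho).
    rewrite mulr1 lerD// ler_wpM2r ?sqr_ge0//.
    have -> : 1 / (4 * r ^+ 2) = 1 / r ^+ 2 / 4 by field; rewrite gt_eqF.
    rewrite ler_wpM2r// scal_le//; exact: subset_geodesic_ball pE.
  have [|-> h] := uoff p; first by move=> Ep; rewrite mem_set in pE.
  by rewrite expr0n/= !mulr0 !addr0.
move=> NI.
have W2 : W ^+ 2 <= d ^+ 2 * r ^+ 2.
  rewrite -exprMn lerXn2r ?nnegrE ?(ltW W0) ?mulr_ge0 ?(ltW d0) ?(ltW r0)//.
  rewrite -(ler_pXn2r (n := 3))// ?nnegrE ?(ltW W0) ?mulr_ge0 ?(ltW d0) ?(ltW r0)//.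
  rewrite W3 -lee_fin -VE ltW// (le_lt_trans (ball_volume_le rr))//.
(* Once the terms in I2 are absorbed into N, what is left is
   N d^2 (64 A - A / 4) <= (5 / 2)^2 A V(rho). *)
have NV : 51 / 5 * d ^+ 2 * N <= V rho.
  have r20 : 0 < r ^+ 2 by exact: exprn_gt0.
  have rL2 : r ^+ 2 <= L ^+ 2 by rewrite lerXn2r ?nnegrE ?(ltW r0)// (le_trans (ltW r0)).
  have I2le : I2 / r ^+ 2 <= N * d ^+ 2.
    rewrite ler_pdivrMr// (le_trans u2)// -mulrA ler_wpM2l// ltW//.
  have I2r : 0 <= I2 / r ^+ 2 by rewrite divr_ge0// ltW.
  have BI : B * I2 <= B * L ^+ 2 * (I2 / r ^+ 2).
    rewrite -mulrA ler_wpM2l ?(ltW B0)// -[leLHS](divfK (lt0r_neq0 r20)) mulrC.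
    by rewrite ler_wpM2r.
  have E4 : 1 / (4 * r ^+ 2) * I2 = (I2 / r ^+ 2) / 4 by field; rewrite gt_eqF.
  rewrite E4 in NI.
  have L2 : 0 <= L ^+ 2 by exact: sqr_ge0.
  have BL : 0 <= B * L ^+ 2 by rewrite mulr_ge0 ?(ltW B0).
  have c0 : 0 <= A / 4 + B * L ^+ 2 by rewrite addr_ge0// divr_ge0// ltW.
  have h1 : (A / 4 + B * L ^+ 2) * (I2 / r ^+ 2) <=
      (A / 4 + B * L ^+ 2) * (N * d ^+ 2) by rewrite ler_wpM2l.
  have N1 : N = N * d ^+ 2 * (64 * A + 2 * B * L ^+ 2) by rewrite -mulrA dE mulr1.
  have Nd : 0 <= N * d ^+ 2 by rewrite mulr_ge0 ?sqr_ge0// ltW.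
  have h2 : 0 <= N * d ^+ 2 * (B * L ^+ 2) by rewrite mulr_ge0.
  rewrite -(ler_pM2l A0); lra.
have -> : 8 * (d * rho) ^+ 6 * V (rho / 2) =
    8 * d ^+ 6 * (rho ^+ 6 * V (rho / 2)) by rewrite exprMn; ring.
have NV3 : (51 / 5 * d ^+ 2 * N) ^+ 3 <= V rho ^+ 3.
  rewrite lerXn2r ?nnegrE ?(ltW V0)//.
  apply: mulr_ge0 (ltW N0); apply: mulr_ge0 (sqr_ge0 d); lra.
apply: le_trans NV3.
have -> : (51 / 5 * d ^+ 2 * N) ^+ 3 = (51 / 5) ^+ 3 * d ^+ 6 * N ^+ 3 by ring.
rewrite N3; rewrite exprMn in I6_ge.
have d6 : 0 <= d ^+ 6 by rewrite exprn_ge0// ltW.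
have V20 := ball_volume_gt0 (ltac:(lra) : 0 < rho / 2) rho2r.
have P0 : 0 <= rho ^+ 6 * V (rho / 2) by rewrite mulr_ge0 ?(ltW V20)// exprn_ge0// ltW.
have := ler_wpM2l d6 I6_ge; have := mulr_ge0 d6 P0.
move: (rho ^+ 6) (V (rho / 2)) (d ^+ 6) => *; lra.
Qed.

End VolumeStep.

(** If the bound failed, e(r) < 1 would force the ratios e(r / 2^m) to zero,
whereas small balls have volume at least a multiple of the cube of their
radius. *)
Lemma volume_lower_bound (R : realType) (M : ptopologicalType)
    (X : smooth_structure R M 3) (g : metric_tensor R M 3)
    (vol : {measure set (borel M) -> \bar R}) (A B L r : R) (x : M) :
  compact [set: M] -> is_riemannian X g -> is_volume X g vol ->
  sobolev_inequality X g vol A B -> 0 < A -> 0 < B -> 0 < r -> r <= L ->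
  (forall y, geodesic_ball X g x r y -> scalar_curvature X g y <= 1 / r ^+ 2) ->
  (((1 / (64 * A + 2 * B * L ^+ 2)) `^ (3 / 2) * r ^+ 3)%:E <=
     vol (geodesic_ball X g x r))%E.
Proof.
move=> cM hg volP sob A0 B0 r0 rL scal_le; rewrite leNgt; apply/negP.
set D := 1 / _ => Vr.
have den0 : 0 < 64 * A + 2 * B * L ^+ 2.
  by rewrite ltr_pwDl ?mulr_gt0// mulr_ge0 ?sqr_ge0// mulr_ge0 ?(ltW B0).
have D0 : 0 < D by rewrite divr_gt0.
pose d := Num.sqrt D; have d0 : 0 < d by rewrite sqrtr_gt0.
have dD : d ^+ 2 = D by rewrite sqr_sqrtr ?ltW.
have dE : d ^+ 2 * (64 * A + 2 * B * L ^+ 2) = 1.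
  by rewrite dD /D mul1r mulVf ?gt_eqF.
have {}Vr : (vol (geodesic_ball X g x r) < ((d * r) ^+ 3)%:E)%E.
  rewrite exprMn (_ : d ^+ 3 = D `^ (3 / 2))//.
  by rewrite /d -powR12_sqrt ?(ltW D0)// -powR_mulrn ?powR_ge0// -powRrM mulrC.
have [v0 [r1 [v00 r10 small]]] := small_ball_volume hg cM x volP.
have ball_gt0 rho : 0 < rho -> (0 < vol (geodesic_ball X g x rho))%E.
  move=> rho0; pose s := Num.min rho r1.
  have s0 : 0 < s by rewrite lt_min rho0.
  apply: (@lt_le_trans _ _ (vol (geodesic_ball X g x s))); last first.
    apply: le_measure; rewrite ?inE; [exact: measurable_geodesic_ball|
      exact: measurable_geodesic_ball|apply: subset_geodesic_ball].
    by rewrite ge_min lexx.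
  apply: (lt_le_trans _ (small s _)); last by rewrite s0 ge_min lexx orbT.
  by rewrite lte_fin mulr_gt0// exprn_gt0.
pose rho m := r / 2 ^+ m.
have rho0 m : 0 < rho m by rewrite divr_gt0// exprn_gt0.
have rhor m : rho m <= r.
  by rewrite ler_pdivrMr ?exprn_gt0// ler_peMr ?(ltW r0)// exprn_ege1// ler1n.
have rhoS m : rho m.+1 = rho m / 2 by rewrite /rho exprSr invfM mulrA.
pose V m := fine (vol (geodesic_ball X g x (rho m))).
have VE m : vol (geodesic_ball X g x (rho m)) = (V m)%:E.
  exact: (ball_volume_fine hg cM Vr).
pose e m := V m / (d * rho m) ^+ 3.
have dr0 m : 0 < (d * rho m) ^+ 3 by rewrite exprn_gt0// mulr_gt0.
have : 1 <= e 0%N.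
  apply: (@cubic_recursion_ge1 _ _ (v0 / d ^+ 3)).
  - by rewrite divr_gt0// exprn_gt0.
  - have rho_r1 : \forall m \near \oo, rho m <= r1.
      near=> m; rewrite /rho ler_pdivrMr ?exprn_gt0// -ler_pdivrMl//.
      have : r1^-1 * r <= m%:R by near: m; exact: nbhs_infty_ger.
      move=> /le_trans; apply; rewrite -natrX ler_nat ltnW// ltn_expl//.
    apply: filterS rho_r1 => m rm; rewrite ler_pdivlMr// exprMn mulrA.
    rewrite divfK ?gt_eqF ?exprn_gt0// -lee_fin -VE.
    by apply: small; rewrite rho0.
  - by move=> m; rewrite divr_ge0 ?(ltW (dr0 m))// fine_ge0.
  - move=> m; have dm : 0 < d * rho m by rewrite mulr_gt0.
    rewrite /e expr_div_n ler_pdivrMr// mulrAC ler_pdivlMr ?exprn_gt0//.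
    have := volume_halving hg cM ball_gt0 A0 B0 r0 rL d0 sob scal_le dE Vr (rho0 m) (rhor m).
    rewrite -rhoS -/(V m.+1) -/(V m) => h.
    rewrite rhoS; move: (ler_wpM2r (ltW (dr0 m)) h).
    lra.
rewrite /e ler_pdivlMr// mul1r leNgt -lte_fin -VE /rho expr0 divr1.
by rewrite Vr.
Unshelve. all: by end_near. Qed.

Theorem theoremE (R : realType) (n : nat) (hn : n = 3%N)
    (M : ptopologicalType) (X : smooth_structure R M n)
    (compactM : compact [set: M]) (connectedM : connected [set: M])
    (T : \bar R) (T_gt0 : (0 < T)%E)
    (g0 : metric_tensor R M n) (g : R -> metric_tensor R M n)
    (flow : is_ricci_flow X T g0 g)
    (lambda0 : is_lambda0 X g0 0)
    (vol : R -> {measure set (borel M) -> \bar R})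
    (volP : forall t, 0 <= t -> (t%:E < T)%E -> is_volume X (g t) (vol t))
    (A B : R) (A_gt0 : 0 < A) (B_gt0 : 0 < B)
    (sobolev : forall t, 0 <= t -> (t%:E < T)%E ->
       sobolev_inequality X (g t) (vol t) A B)
    (L : R) (L_gt0 : 0 < L)
    (t : R) (t_ge0 : 0 <= t) (t_ltT : (t%:E < T)%E)
    (x : M) (r : R) (r_gt0 : 0 < r) (r_leL : r <= L)
    (scal_le : forall y, geodesic_ball X (g t) x r y ->
       scalar_curvature X (g t) y <= 1 / r ^+ 2) :
  (((1 / (2 ^+ (n + 3) * A + 2 * B * L ^+ 2)) `^ (n%:R / 2) * r ^+ n)%:E
     <= vol t (geodesic_ball X (g t) x r))%E.
Proof.
subst n; have [hg _ _ _] := flow.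
have -> : 2 ^+ (3 + 3) = 64 :> R by rewrite -natrX.
apply: (volume_lower_bound compactM _ (volP t t_ge0 t_ltT) (sobolev t t_ge0 t_ltT)) => //.
exact: hg.
Qed.
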